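(* $\theta_1^*=1$.
   Context: For $d\ge1$, call a probability density $f$ on $\mathbb R^d$ admissible if it is smooth, strictly positive, rapidly decaying, and $\mathcal Q[f]>0$. Define $\theta_d^*=\inf_f \mathcal I[f]\mathcal D[f]/\mathcal Q[f]^2$, the infimum over admissible densities on $\mathbb R^d$. Here, writing $f=e^u$ and $\mathsf H_f=-\nabla^2u$: $\mathcal I[f]=\int\operatorname{tr}(\mathsf H_f)f\,dx$, $\mathcal Q[f]=\int\operatorname{tr}(\mathsf H_f^2)f\,dx$, $\mathcal D[f]=\int(|\nabla\mathsf H_f|^2+2\operatorname{tr}(\mathsf H_f^3))f\,dx$, with $|\nabla\mathsf H_f|^2=\sum_{i,j,k}(\partial_k(\mathsf H_f)_{ij})^2$. (In dimension one, $\mathsf H_f=-(\log f)''$.) *)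

(* Defs.v *)
From Stdlib Require Import Reals.
From Coquelicot Require Import Coquelicot.
Open Scope R_scope.

Definition whole_line_integrable (g : R -> R) : Prop :=
  ex_RInt_gen g (Rbar_locally m_infty) (Rbar_locally p_infty) /\
  ex_RInt_gen (fun x => Rabs (g x)) (Rbar_locally m_infty) (Rbar_locally p_infty).

Definition integral_R (g : R -> R) : R :=
  RInt_gen g (Rbar_locally m_infty) (Rbar_locally p_infty).

Definition smooth (f : R -> R) : Prop := forall (n : nat) (x : R), ex_derive_n f n x.

Definition rapidly_decaying (f : R -> R) : Prop :=
  forall n k : nat,
    is_lim (fun x => x ^ k * Derive_n f n x) p_infty 0 /\
    is_lim (fun x => x ^ k * Derive_n f n x) m_infty 0.

Definition Hf (f : R -> R) (x : R) : R := - Derive_n (fun y => ln (f y)) 2 x.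

Definition I_integrand (f : R -> R) (x : R) : R := Hf f x * f x.
Definition Q_integrand (f : R -> R) (x : R) : R := (Hf f x) ^ 2 * f x.
Definition D_integrand (f : R -> R) (x : R) : R :=
  ((Derive (Hf f) x) ^ 2 + 2 * (Hf f x) ^ 3) * f x.

Definition I_fun (f : R -> R) : R := integral_R (I_integrand f).
Definition Q_fun (f : R -> R) : R := integral_R (Q_integrand f).
Definition D_fun (f : R -> R) : R := integral_R (D_integrand f).

Definition admissible (f : R -> R) : Prop :=
  smooth f /\
  (forall x, 0 < f x) /\
  rapidly_decaying f /\
  is_RInt_gen f (Rbar_locally m_infty) (Rbar_locally p_infty) 1 /\
  whole_line_integrable (I_integrand f) /\
  whole_line_integrable (Q_integrand f) /\
  whole_line_integrable (D_integrand f) /\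
  0 < Q_fun f.

Definition ratio_set (r : R) : Prop :=
  exists f : R -> R, admissible f /\ r = I_fun f * D_fun f / (Q_fun f) ^ 2.

(* Main.v *)
Require Import Defs.
From Stdlib Require Import Reals Lra Lia FunctionalExtensionality.
From Coquelicot Require Import Coquelicot.

(* Lower bound. With s = (log f)', v = Hf f = - s' and any real l, put
   w = v' + 2 s v - s^3/3 - l s.  Then
     (v'^2 + 2 v^3 - 2 l v^2 + l^2 v) f = (w^2 + s^6/45) f + (phi f)'
   for a polynomial phi in s and v, so formally D - 2 l Q + l^2 I >= 0 for all l, which forces
   I > 0 and I D >= Q^2.  Nothing controls phi f at infinity directly; instead the identity is
   multiplied by the cutoff rho^6, rho = 1 - (x/r)^2, on [-r, r].  The terms carrying the derivative
   of the cutoff are of size 1/r times f (w^2 rho^6 + s^6 rho^6 + v^2 + 1): the first two are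
   absorbed by the square, the other two are integrable.

   Sharpness. The density proportional to exp (- d x^2/2 + e cos x) with d = e^4 behaves, as e -> 0,
   like a small periodic perturbation of a flat density, for which I, Q and D all equal e^2/2
   to leading order.  The moments of cos are estimated through E[p' + p u'] = 0 with u = log f. *)

(** * Improper integrals over the line *)

Lemma ex_RInt_cont (g : R -> R) :
  (forall x, continuous g x) -> forall a b, ex_RInt g a b.
Proof. intros Hg a b. apply (ex_RInt_continuous (V := R_CompleteNormedModule)). auto. Qed.

Lemma continuous_Rabs_comp (g : R -> R) x :
  continuous g x -> continuous (fun y => Rabs (g y)) x.
Proof. intros H. apply (continuous_comp g Rabs); [exact H | apply continuous_Rabs]. Qed.

Lemma is_RInt_gen_near (g : R -> R) (l : R) :
  is_RInt_gen g (Rbar_locally m_infty) (Rbar_locally p_infty) l ->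
  forall eps, 0 < eps -> exists M, 0 < M /\
    forall a b, a <= - M -> M <= b -> Rabs (RInt g a b - l) < eps.
Proof.
  intros H eps He.
  assert (HP : locally l (fun y => Rabs (y - l) < eps)).
  { exists (mkposreal eps He). intros y Hy. exact Hy. }
  destruct (H _ HP) as [P Q [m Hm] [p Hp] HPQ].
  exists (Rmax 1 (Rmax (- m + 1) (p + 1))).
  assert (H1 := Rmax_l 1 (Rmax (- m + 1) (p + 1))).
  assert (H2 := Rmax_r 1 (Rmax (- m + 1) (p + 1))).
  assert (H3 := Rmax_l (- m + 1) (p + 1)).
  assert (H4 := Rmax_r (- m + 1) (p + 1)).
  split; [lra|].
  intros a b Ha Hb.
  destruct (HPQ a b) as [y [Hy1 Hy2]]; [apply Hm; lra | apply Hp; lra |].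
  simpl in Hy1. rewrite (is_RInt_unique _ _ _ _ Hy1). exact Hy2.
Qed.

Lemma is_RInt_gen_seq (g : R -> R) (l : R) :
  is_RInt_gen g (Rbar_locally m_infty) (Rbar_locally p_infty) l ->
  is_lim_seq (fun n => RInt g (- INR n) (INR n)) l.
Proof.
  intros H. apply is_lim_seq_spec. intros [eps He]. simpl.
  destruct (is_RInt_gen_near g l H eps He) as [M [HM Hn]].
  destruct (nfloor_ex M) as [N [_ HN]]; [lra|].
  exists (S N). intros n Hn'.
  assert (M <= INR n). { apply le_INR in Hn'. rewrite S_INR in Hn'. lra. }
  apply Hn; lra.
Qed.

(** The arctangent enters as primitive of the majorant [1 / (1 + x ^ 2)]; its finite limits at both
    ends are what makes that majorant integrable. *)
Lemma filterlim_atan_p : filterlim atan (Rbar_locally p_infty) (locally (PI / 2)).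
Proof.
  apply (is_lim_ext_loc (fun x => PI / 2 - atan (/ x)) atan p_infty (PI / 2)).
  - exists 0. intros x Hx. rewrite (atan_inv x Hx). ring.
  - evar_last.
    { apply is_lim_minus'. apply is_lim_const.
      apply (is_lim_comp atan Rinv p_infty (atan 0) 0).
      - apply is_lim_continuity. apply derivable_continuous_pt, ex_derive_Reals_0. auto_derive. auto.
      - apply (is_lim_inv (fun x => x) p_infty p_infty). apply is_lim_id. discriminate.
      - exists 0. intros x Hx Heq. injection Heq. apply Rinv_neq_0_compat. lra. }
    simpl. rewrite atan_0. apply f_equal. ring.
Qed.

Lemma filterlim_atan_m : filterlim atan (Rbar_locally m_infty) (locally (- (PI / 2))).
Proof.
  apply (is_lim_ext (fun x => - atan (- x)) atan m_infty (- (PI / 2))).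
  - intros x. rewrite atan_opp. ring.
  - apply (is_lim_opp (fun x => atan (- x)) m_infty (PI / 2)).
    apply (is_lim_comp atan Ropp m_infty (PI / 2) p_infty).
    + exact filterlim_atan_p.
    + apply (is_lim_opp (fun x => x) m_infty m_infty). apply is_lim_id.
    + exists 0. intros; discriminate.
Qed.

Lemma is_RInt_inv_1_sqr C a b :
  is_RInt (fun x => C / (1 + x ^ 2)) a b (C * atan b - C * atan a).
Proof.
  apply (is_RInt_derive (fun x => C * atan x)).
  - intros x _. auto_derive. auto. unfold Rsqr. field. nra.
  - intros x _. apply continuity_pt_filterlim.
    apply derivable_continuous_pt. exists (- C * (2 * x) / (1 + x ^ 2) ^ 2).
    apply is_derive_Reals. auto_derive. nra. field. nra.
Qed.

(** The outer absolute value on the right covers both orders of the endpoints, since the Cauchy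
    criterion supplies them in no particular order. *)
Lemma RInt_abs_le_atan (g : R -> R) C :
  (forall x, continuous g x) -> (forall x, Rabs (g x) <= C / (1 + x ^ 2)) ->
  forall a b, Rabs (RInt g a b) <= Rabs (C * atan b - C * atan a).
Proof.
  intros Hc Hb.
  assert (K : forall a b, a <= b -> Rabs (RInt g a b) <= C * atan b - C * atan a).
  { intros a b Hab.
    apply (norm_RInt_le g (fun x => C / (1 + x ^ 2)) a b).
    - exact Hab.
    - intros x _. apply Hb.
    - apply (RInt_correct (V := R_CompleteNormedModule)). apply ex_RInt_cont, Hc.
    - apply is_RInt_inv_1_sqr. }
  intros a b. destruct (Rle_dec a b) as [H|H].
  - eapply Rle_trans. apply K, H. apply Rle_abs.
  - rewrite <- (opp_RInt_swap (V := R_CompleteNormedModule)) by (apply ex_RInt_cont, Hc).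
    simpl. rewrite Rabs_minus_sym. change (opp ?x) with (- x). rewrite Rabs_Ropp.
    eapply Rle_trans. apply K; lra. apply Rle_abs.
Qed.

(** Increments of the primitive are dominated by those of [C * atan], which is Cauchy along [F]
    because it converges; completeness of the reals concludes. The filter is kept abstract so that
    both infinities are instances. *)
Lemma ex_filterlim_primitive (g : R -> R) C (F : (R -> Prop) -> Prop) (FF : ProperFilter F) l :
  (forall x, continuous g x) -> (forall x, Rabs (g x) <= C / (1 + x ^ 2)) ->
  filterlim atan F (locally l) ->
  exists y : R, filterlim (fun x => RInt g 0 x) F (locally y).
Proof.
  intros Hc Hb Hl.
  apply (proj1 (filterlim_locally_cauchy (U := R_CompleteSpace) (F := F) (fun x => RInt g 0 x))).
  intros [eps He].
  assert (Hl' : filterlim (fun x => C * atan x) F (locally (C * l))).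
  { apply (filterlim_comp _ _ _ atan (fun y => C * y) F (locally l)); [exact Hl|].
    apply (filterlim_scal_r C l). }
  destruct (proj2 (filterlim_locally_cauchy (U := R_CompleteSpace) (F := F) (fun x => C * atan x))
    (ex_intro _ (C * l) Hl') (mkposreal eps He)) as [P [HP HPP]].
  exists P. split; [exact HP|]. intros u v Hu Hv.
  specialize (HPP u v Hu Hv).
  change (Rabs (RInt g 0 v - RInt g 0 u) < eps).
  change (Rabs (C * atan v - C * atan u) < eps) in HPP.
  assert (RInt g 0 v - RInt g 0 u = RInt g u v) as ->.
  { rewrite <- (RInt_Chasles (V := R_CompleteNormedModule) g 0 u v); try (apply ex_RInt_cont, Hc).
    change plus with Rplus. simpl. unfold Rminus. ring. }
  eapply Rle_lt_trans. apply (RInt_abs_le_atan g C Hc Hb). exact HPP.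
Qed.

Lemma is_RInt_gen_primitive (F f : R -> R) la lb :
  (forall x, is_derive F x (f x)) -> (forall x, continuous f x) ->
  is_lim F m_infty (Finite la) -> is_lim F p_infty (Finite lb) ->
  is_RInt_gen f (Rbar_locally m_infty) (Rbar_locally p_infty) (lb - la).
Proof.
  intros Hd Hc Ha Hb.
  assert (E : Derive F = f) by (apply functional_extensionality; intros x; apply is_derive_unique, Hd).
  rewrite <- E. apply is_RInt_gen_Derive; try assumption.
  - apply filter_forall. intros ab x _. eexists; apply Hd.
  - apply filter_forall. intros ab x _. rewrite E. apply Hc.
Qed.

Lemma whole_line_integrable_bound (g : R -> R) C :
  (forall x, continuous g x) -> (forall x, Rabs (g x) <= C / (1 + x ^ 2)) ->
  whole_line_integrable g.
Proof.
  (* [K] is stated for every function because it is applied twice, to [g] and to its absolute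
     value. *)
  assert (K : forall g, (forall x, continuous g x) -> (forall x, Rabs (g x) <= C / (1 + x ^ 2)) ->
    ex_RInt_gen g (Rbar_locally m_infty) (Rbar_locally p_infty)).
  { clear g. intros g Hc Hb.
    destruct (ex_filterlim_primitive g C _ _ _ Hc Hb filterlim_atan_p) as [lb Hlb].
    destruct (ex_filterlim_primitive g C _ _ _ Hc Hb filterlim_atan_m) as [la Hla].
    exists (lb - la). apply (is_RInt_gen_primitive (fun x => RInt g 0 x)); try assumption.
    intros x. apply (is_derive_RInt _ _ 0).
    - apply filter_forall. intros y. apply (RInt_correct (V := R_CompleteNormedModule)).
      apply ex_RInt_cont, Hc.
    - apply Hc. }
  intros Hc Hb. split; [apply K; assumption|].
  apply K.
  - intros x. apply continuous_Rabs_comp, Hc.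
  - intros x. rewrite Rabs_Rabsolu. apply Hb.
Qed.

Lemma is_RInt_gen_integral_R (g : R -> R) :
  whole_line_integrable g ->
  is_RInt_gen g (Rbar_locally m_infty) (Rbar_locally p_infty) (integral_R g).
Proof.
  intros [H _]. exact (RInt_gen_correct (V := R_CompleteNormedModule) g H).
Qed.

(** * The polynomial cutoff and convergence of the cut-off integrals *)

Lemma continuous_mult_R (f g : R -> R) x :
  continuous f x -> continuous g x -> continuous (fun y => f y * g y) x.
Proof. intros Hf Hg. exact (continuous_mult (K := R_AbsRing) f g x Hf Hg). Qed.

Lemma ex_derive_continuous_R (f : R -> R) (x : R) : ex_derive f x -> continuous f x.
Proof. exact (ex_derive_continuous (K := R_AbsRing) (V := R_NormedModule) f x). Qed.

Lemma cutoff_continuous r x : continuous (fun y => (1 - (y / r) ^ 2) ^ 6) x.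
Proof. apply ex_derive_continuous_R. auto_derive. auto. Qed.

Lemma cutoff_bounds r x : 0 < r -> - r <= x <= r ->
  0 <= 1 - (1 - (x / r) ^ 2) ^ 6 <= 1.
Proof.
  intros Hr Hx.
  assert (H0 : - 1 <= x / r <= 1).
  { split; [apply Rle_div_r | apply Rle_div_l]; lra. }
  assert (H1 : 0 <= 1 - (x / r) ^ 2 <= 1) by nra.
  assert (H2 := pow_le _ 6 (proj1 H1)).
  assert (H3 := pow_incr _ _ 6 H1). rewrite pow1 in H3. lra.
Qed.

(** Bernoulli's inequality [1 - 6 * q <= (1 - q) ^ 6] at [q = (x / r) ^ 2]: on a fixed window the
    cutoff tends to 1 uniformly as [r] grows. *)
Lemma cutoff_near_1 r A x : 0 < A -> A <= r -> - A <= x <= A ->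
  1 - (1 - (x / r) ^ 2) ^ 6 <= 6 * A ^ 2 / r ^ 2.
Proof.
  intros HA Hr Hx.
  assert (H0 : (x / r) ^ 2 <= A ^ 2 / r ^ 2).
  { unfold Rdiv. rewrite Rpow_mult_distr, pow_inv. apply Rmult_le_compat_r.
    apply Rlt_le, Rinv_0_lt_compat, pow_lt. lra. nra. }
  assert (H1 : A ^ 2 / r ^ 2 <= 1).
  { apply Rle_div_l. apply pow_lt; lra. nra. }
  replace (6 * A ^ 2 / r ^ 2) with (6 * (A ^ 2 / r ^ 2)) by (field; lra).
  set (q := (x / r) ^ 2) in *.
  assert (0 <= q) by apply pow2_ge_0.
  assert (1 - 6 * q <= (1 - q) ^ 6); [|lra].
  assert (Hq : 0 <= 1 - q) by lra.
  assert (B : forall n, 1 - INR n * q <= (1 - q) ^ n).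
  { induction n.
    - simpl. lra.
    - rewrite S_INR. simpl pow.
      assert (0 <= INR n) by apply pos_INR. 
      apply Rle_trans with ((1 - q) * (1 - INR n * q)); [nra|].
      apply Rmult_le_compat_l; lra. }
  specialize (B 6%nat). simpl INR in B. lra.
Qed.

Lemma RInt_Chasles_R (g : R -> R) a b c : (forall x, continuous g x) ->
  RInt g a b + RInt g b c = RInt g a c.
Proof.
  intros Hg. apply (RInt_Chasles (V := R_CompleteNormedModule)); apply ex_RInt_cont, Hg.
Qed.

Lemma RInt_scal_R (g : R -> R) k a b : (forall x, continuous g x) ->
  RInt (fun x => k * g x) a b = k * RInt g a b.
Proof.
  intros Hg. apply (RInt_scal (V := R_CompleteNormedModule)); apply ex_RInt_cont, Hg.
Qed.

Lemma RInt_plus_R (g h : R -> R) a b : 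
  (forall x, continuous g x) -> (forall x, continuous h x) ->
  RInt (fun x => g x + h x) a b = RInt g a b + RInt h a b.
Proof.
  intros Hg Hh. apply (RInt_plus (V := R_CompleteNormedModule)); apply ex_RInt_cont; assumption.
Qed.

(** The window is split at [- A] and [A]. Outside, the cutoff loses at most all of [Rabs (g x)];
    inside, it loses at most the fraction given by Bernoulli. *)
Lemma RInt_cutoff_error (g : R -> R) A r :
  (forall x, continuous g x) -> 0 < A -> A <= r ->
  Rabs (RInt g (- r) r - RInt (fun x => g x * (1 - (x / r) ^ 2) ^ 6) (- r) r)
  <= RInt (fun x => Rabs (g x)) (- r) r - RInt (fun x => Rabs (g x)) (- A) A
     + 6 * A ^ 2 / r ^ 2 * RInt (fun x => Rabs (g x)) (- A) A.
Proof.
  intros Hg HA Hr.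
  assert (Ha : forall x, continuous (fun y => Rabs (g y)) x)
    by (intros; apply continuous_Rabs_comp, Hg).
  assert (Hgc : forall x, continuous (fun y => g y * (1 - (y / r) ^ 2) ^ 6) x)
    by (intros; apply continuous_mult_R; [apply Hg | apply cutoff_continuous]).
  set (k := fun x => Rabs (g x) * (1 - (1 - (x / r) ^ 2) ^ 6)).
  assert (Hk : forall x, continuous k x).
  { intros x. apply continuous_mult_R. apply Ha. apply ex_derive_continuous_R. auto_derive. auto. }
  assert (H1 : Rabs (RInt g (- r) r - RInt (fun x => g x * (1 - (x / r) ^ 2) ^ 6) (- r) r)
    <= RInt k (- r) r).
  { apply (norm_RInt_le (fun x => g x - g x * (1 - (x / r) ^ 2) ^ 6) k (- r) r).
    - lra.
    - intros x Hx. unfold k. change norm with Rabs.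
      replace (g x - g x * (1 - (x / r) ^ 2) ^ 6) with (g x * (1 - (1 - (x / r) ^ 2) ^ 6)) by ring.
      rewrite Rabs_mult. right. f_equal. apply Rabs_pos_eq. apply cutoff_bounds; lra.
    - apply (is_RInt_minus (V := R_NormedModule)); 
        apply (RInt_correct (V := R_CompleteNormedModule)), ex_RInt_cont; assumption.
    - apply (RInt_correct (V := R_CompleteNormedModule)), ex_RInt_cont; assumption. }
  eapply Rle_trans; [exact H1|].
  rewrite <- (RInt_Chasles_R k (- r) (- A) r), <- (RInt_Chasles_R k (- A) A r) by exact Hk.
  rewrite <- (RInt_Chasles_R (fun x => Rabs (g x)) (- r) (- A) r),
    <- (RInt_Chasles_R (fun x => Rabs (g x)) (- A) A r) by exact Ha.
  assert (Hout : forall a b, - r <= a -> a <= b -> b <= r -> 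
    RInt k a b <= RInt (fun x => Rabs (g x)) a b).
  { intros a b H2 H3 H4. apply RInt_le; try (apply ex_RInt_cont; assumption). exact H3.
    intros x Hx. unfold k. assert (H5 := Rabs_pos (g x)).
    assert (H6 := cutoff_bounds r x). nra. }
  assert (Hin : RInt k (- A) A <= 6 * A ^ 2 / r ^ 2 * RInt (fun x => Rabs (g x)) (- A) A).
  { rewrite <- RInt_scal_R by exact Ha. apply RInt_le. lra.
    apply ex_RInt_cont; exact Hk.
    apply ex_RInt_cont; intros; apply continuous_mult_R. apply continuous_const. apply Ha.
    intros x Hx. unfold k. rewrite Rmult_comm. apply Rmult_le_compat_r. apply Rabs_pos.
    apply cutoff_near_1; lra. }
  assert (H7 := Hout (- r) (- A)). assert (H8 := Hout A r). lra.
Qed.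

(** Dominated convergence by hand: [A] is fixed first to make the tail of the absolute value small,
    then [n] is taken large enough for the loss on the inner window. *)
Lemma cutoff_integral_lim (g : R -> R) :
  (forall x, continuous g x) -> whole_line_integrable g ->
  is_lim_seq (fun n => RInt (fun x => g x * (1 - (x / INR n) ^ 2) ^ 6) (- INR n) (INR n))
    (integral_R g).
Proof.
  intros Hg Hi.
  assert (H1 := is_RInt_gen_seq _ _ (is_RInt_gen_integral_R g Hi)).
  destruct Hi as [_ [L HL]].
  cut (is_lim_seq (fun n => RInt g (- INR n) (INR n)
    - RInt (fun x => g x * (1 - (x / INR n) ^ 2) ^ 6) (- INR n) (INR n)) 0).
  { intros H2. assert (H3 := is_lim_seq_minus' _ _ _ _ H1 H2).
    replace (integral_R g) with (integral_R g - 0) by ring.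
    revert H3. apply is_lim_seq_ext. intros n. ring. }
  apply is_lim_seq_spec. intros [eps He]. simpl.
  destruct (is_RInt_gen_near _ L HL (eps / 4)) as [A [HA Hn]]; [lra|].
  assert (HAA := Hn (- A) A (Rle_refl _) (Rle_refl _)).
  set (J := RInt (fun x => Rabs (g x)) (- A) A) in *.
  assert (HJ : 0 <= J).
  { apply RInt_ge_0. lra. apply ex_RInt_cont. intros; apply continuous_Rabs_comp, Hg.
    intros; apply Rabs_pos. }
  (* The tail costs at most two quarters of [eps] and the inner window a third one. The summand
     [+ 1] ensures [1 <= INR n], hence [INR n <= INR n ^ 2]. *)
  destruct (nfloor_ex (Rmax A (24 * A ^ 2 * J / eps + 1))) as [N [_ HN]].
  { apply Rle_trans with A. lra. apply Rmax_l. }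
  exists (S N). intros n Hn'.
  assert (HnN : Rmax A (24 * A ^ 2 * J / eps + 1) <= INR n).
  { apply le_INR in Hn'. rewrite S_INR in Hn'. lra. }
  assert (H2 := Rle_trans _ _ _ (Rmax_l _ _) HnN).
  assert (H3 := Rle_trans _ _ _ (Rmax_r _ _) HnN).
  assert (H4 : 0 <= 24 * A ^ 2 * J / eps).
  { apply Rmult_le_pos. assert (0 <= A ^ 2) by apply pow2_ge_0. nra.
    apply Rlt_le, Rinv_0_lt_compat, He. }
  rewrite Rminus_0_r.
  eapply Rle_lt_trans. apply (RInt_cutoff_error g A (INR n) Hg HA H2).
  assert (H5 := Hn (- INR n) (INR n)). 
  assert (H6 : Rabs (RInt (fun x => Rabs (g x)) (- INR n) (INR n) - L) < eps / 4) by (apply H5; lra).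
  fold J.
  assert (H7 : 6 * A ^ 2 / INR n ^ 2 * J <= eps / 4).
  { replace (6 * A ^ 2 / INR n ^ 2 * J) with ((6 * A ^ 2 * J) / INR n ^ 2) by (field; lra).
    apply Rle_div_l. apply pow_lt; lra.
    assert (24 * A ^ 2 * J <= eps * INR n).
    { rewrite (Rmult_comm eps). apply Rle_div_l; lra. }
    assert (eps * INR n * 1 <= eps * INR n * INR n) by (apply Rmult_le_compat_l; nra).
    lra. }
  apply Rabs_def2 in H6. apply Rabs_def2 in HAA. lra.
Qed.

(** * Pointwise control of the terms carrying the derivative of the cutoff *)

Lemma sixth_power_dominates t :
  t ^ 2 <= t ^ 6 + 1 /\ Rabs t <= t ^ 6 + 1 /\ Rabs t ^ 3 <= t ^ 6 + 1 /\ Rabs t ^ 5 <= t ^ 6 + 1.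
Proof.
  assert (E : t ^ 6 = Rabs t ^ 6).
  { rewrite RPow_abs. symmetry. apply Rabs_pos_eq. replace (t ^ 6) with ((t ^ 3) ^ 2) by ring. apply pow2_ge_0. }
  rewrite E, <- (pow2_abs t). assert (H := Rabs_pos t). set (a := Rabs t) in *. clearbody a.
  assert (H6 := pow_le a 6 H).
  destruct (Rle_dec a 1) as [H1|H1].
  - assert (K : forall n, a ^ n <= 1). { intros n. rewrite <- (pow1 n). apply pow_incr. lra. }
    assert (H2 := K 2%nat). assert (H3 := K 3%nat). assert (H5 := K 5%nat). lra.
  - assert (K : forall n, (n <= 6)%nat -> a ^ n <= a ^ 6). { intros n Hn. apply Rle_pow. lra. exact Hn. }
    assert (Ha := K 1%nat ltac:(lia)). rewrite pow_1 in Ha.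
    assert (H2 := K 2%nat ltac:(lia)). assert (H3 := K 3%nat ltac:(lia)). assert (H5 := K 5%nat ltac:(lia)). lra.
Qed.

Lemma Rabs_mult_le_sqr a b : Rabs (a * b) <= (a ^ 2 + b ^ 2) / 2.
Proof.
  apply Rabs_le. assert (H1 := pow2_ge_0 (a - b)). assert (H2 := pow2_ge_0 (a + b)).
  split; nra.
Qed.

(** Here the exponent 6 of the cutoff pays off: differentiation leaves [rho ^ 5], enough to attach
    one [rho] to each [s] and [rho ^ 3] to [w], even in the extreme term [s ^ 5]. In the new
    variables [rho * s] and [rho ^ 3 * w], products are handled by AM-GM and pure powers by
    comparison with the sixth. *)
Lemma cutoff_remainder_bound (l s v w rho : R) : 0 <= rho <= 1 ->
  Rabs (rho ^ 5 * (4 / 3 * v * w - 2 / 9 * s ^ 3 * v - 2 / 3 * l * s * v + l ^ 2 * s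
                   + 2 / 3 * l * s ^ 3 + 2 / 15 * s ^ 5))
  <= (1 + Rabs l + l ^ 2) * (w ^ 2 * rho ^ 6 + s ^ 6 * rho ^ 6 + v ^ 2 + 1).
Proof.
  intros Hr.
  destruct (sixth_power_dominates (rho * s)) as [S2 [S1 [S3 S5]]].
  replace (w ^ 2 * rho ^ 6) with ((rho ^ 3 * w) ^ 2) by ring.
  replace (s ^ 6 * rho ^ 6) with ((rho * s) ^ 6) by ring.
  replace (rho ^ 5 * (4 / 3 * v * w - 2 / 9 * s ^ 3 * v - 2 / 3 * l * s * v + l ^ 2 * s
                   + 2 / 3 * l * s ^ 3 + 2 / 15 * s ^ 5))
    with (rho ^ 2 * (4 / 3 * (v * (rho ^ 3 * w)) - 2 / 9 * ((rho * s) ^ 3 * v)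
          - 2 / 3 * (rho ^ 2 * (l * ((rho * s) * v))) + rho ^ 2 * (l ^ 2 * (rho * s))
          + 2 / 3 * (l * (rho * s) ^ 3)) + 2 / 15 * (rho * s) ^ 5) by ring.
  set (W := rho ^ 3 * w). set (t := rho * s) in *. clearbody W t.
  assert (Hr2 : 0 <= rho ^ 2 <= 1) by nra.
  set (q := rho ^ 2) in *. clearbody q. clear Hr.
  rewrite RPow_abs in S3, S5.
  assert (L := Rabs_pos l).
  assert (T6 : 0 <= t ^ 6). { replace (t ^ 6) with ((t ^ 3) ^ 2) by ring. apply pow2_ge_0. }
  assert (A1 : Rabs (4 / 3 * (v * W)) <= 2 / 3 * (v ^ 2 + W ^ 2)) by (rewrite Rabs_mult, (Rabs_pos_eq (4 / 3)) by lra;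
    assert (M := Rabs_mult_le_sqr v W); lra).
  assert (A2 : Rabs (2 / 9 * (t ^ 3 * v)) <= 1 / 9 * (t ^ 6 + v ^ 2)).
  { replace (t ^ 6) with ((t ^ 3) ^ 2) by ring. rewrite Rabs_mult, (Rabs_pos_eq (2 / 9)) by lra.
    assert (M := Rabs_mult_le_sqr (t ^ 3) v). lra. }
  assert (A3 : Rabs (2 / 3 * (q * (l * (t * v)))) <= 1 / 3 * (Rabs l * (t ^ 6 + 1 + v ^ 2))).
  { assert (Rabs (t * v) <= / 2 * (t ^ 6 + 1 + v ^ 2)) by (assert (M := Rabs_mult_le_sqr t v); lra).
    rewrite !Rabs_mult, (Rabs_pos_eq (2 / 3)), (Rabs_pos_eq q), <- Rabs_mult by lra.
    assert (H1 : 0 <= Rabs l * Rabs (t * v)) by (apply Rmult_le_pos; apply Rabs_pos).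
    assert (q * (Rabs l * Rabs (t * v)) <= Rabs l * Rabs (t * v)) by nra.
    assert (Rabs l * Rabs (t * v) <= Rabs l * (/ 2 * (t ^ 6 + 1 + v ^ 2))) by (apply Rmult_le_compat_l; lra).
    lra. }
  assert (L2 : 0 <= l ^ 2) by apply pow2_ge_0.
  assert (A4 : Rabs (q * (l ^ 2 * t)) <= l ^ 2 * (t ^ 6 + 1)).
  { rewrite !Rabs_mult, (Rabs_pos_eq q), (Rabs_pos_eq (l ^ 2)) by lra.
    assert (H1 : 0 <= l ^ 2 * Rabs t) by (apply Rmult_le_pos; [lra | apply Rabs_pos]).
    assert (l ^ 2 * Rabs t <= l ^ 2 * (t ^ 6 + 1)) by (apply Rmult_le_compat_l; lra).
    nra. }
  assert (A5 : Rabs (2 / 3 * (l * t ^ 3)) <= 2 / 3 * (Rabs l * (t ^ 6 + 1))).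
  { rewrite !Rabs_mult, (Rabs_pos_eq (2 / 3)) by lra. apply Rmult_le_compat_l. lra.
    apply Rmult_le_compat_l; lra. }
  assert (A6 : Rabs (2 / 15 * t ^ 5) <= 2 / 15 * (t ^ 6 + 1)).
  { rewrite !Rabs_mult, (Rabs_pos_eq (2 / 15)) by lra. lra. }
  eapply Rle_trans; [apply Rabs_triang|].
  rewrite Rabs_mult, (Rabs_pos_eq q) by lra.
  set (E := 4 / 3 * (v * W) - _ - _ + _ + _).
  assert (HE : Rabs E <= 2 / 3 * (v ^ 2 + W ^ 2) + 1 / 9 * (t ^ 6 + v ^ 2)
     + 1 / 3 * (Rabs l * (t ^ 6 + 1 + v ^ 2)) + l ^ 2 * (t ^ 6 + 1) + 2 / 3 * (Rabs l * (t ^ 6 + 1))).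
  { unfold E. apply Rabs_le_between in A1, A2, A3, A4, A5. apply Rabs_le; split; lra. }
  assert (HE0 := Rabs_pos E).
  assert (q * Rabs E <= Rabs E) by nra.
  assert (V2 := pow2_ge_0 v). assert (W2 := pow2_ge_0 W).
  assert (0 <= Rabs l * v ^ 2) by (apply Rmult_le_pos; lra).
  assert (0 <= Rabs l * W ^ 2) by (apply Rmult_le_pos; lra).
  assert (0 <= l ^ 2 * v ^ 2) by (apply Rmult_le_pos; lra).
  assert (0 <= l ^ 2 * W ^ 2) by (apply Rmult_le_pos; lra).
  lra.
Qed.

(** * The completed square, and the cut-off inequality on a bounded interval *)

Lemma continuous_pow_R (f : R -> R) n x : continuous f x -> continuous (fun y => f y ^ n) x.
Proof.
  intros Hf. induction n; simpl.
  - apply continuous_const.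
  - apply continuous_mult_R; assumption.
Qed.

Ltac cont := repeat lazymatch goal with
  | |- continuous (fun y => _ + _) _ => apply (continuous_plus (V := R_NormedModule))
  | |- continuous (fun y => _ - _) _ => apply (continuous_minus (V := R_NormedModule))
  | |- continuous (fun y => _ / ?c) _ => apply (fun g H => continuous_mult_R g (fun _ => / c) _ H (continuous_const _ _))
  | |- continuous (fun y => _ * _) _ => apply continuous_mult_R
  | |- continuous (fun y => _ ^ _) _ => apply continuous_pow_R
  | |- continuous (fun y => y) _ => apply continuous_id
  | |- continuous (fun y => ?c) _ => apply continuous_const
  | |- continuous (Rmult ?c) ?x => apply (continuous_mult_R (fun _ => c) (fun y => y))
  | |- continuous (fun y => ?g y) ?x => change (continuous g x)
  | H : forall x, continuous ?g x |- continuous ?g ?x => exact (H x)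
  end.

Definition defect (l v v' : R) : R := v' ^ 2 + 2 * v ^ 3 - 2 * l * v ^ 2 + l ^ 2 * v.

(* The polynomial phi of the header. *)
Definition boundary_flux (l s v : R) : R :=
  - 2 * s * v ^ 2 + 2 * l * s * v - l ^ 2 * s - 2 / 3 * l * s ^ 3 + 2 / 3 * s ^ 3 * v - 2 / 15 * s ^ 5.

(** The [w] whose square is completed. *)
Definition defect_root (l s v v' : R) : R := v' + 2 * s * v - s ^ 3 / 3 - l * s.

(** The negative of [boundary_flux] after its term in [s * v ^ 2] has been traded away, with [w]
    standing for [defect_root]. *)
Definition cutoff_remainder (l s v w : R) : R :=
  4 / 3 * v * w - 2 / 9 * s ^ 3 * v - 2 / 3 * l * s * v + l ^ 2 * s + 2 / 3 * l * s ^ 3 + 2 / 15 * s ^ 5.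

(* The term [v ^ 2 * s * f] of the flux is not dominated by [w ^ 2 + s ^ 6 + v ^ 2 + 1];
   where it meets the derivative of the cutoff it is traded, through
   [3 * s * v ^ 2 * f = - (v ^ 2 * f)' + (2 * v * w + 2 / 3 * s ^ 3 * v + 2 * l * s * v) * f],
   for dominated terms, which accounts for the second summand below. *)
Lemma is_derive_cutoff_flux (f s v v' rho rho' : R -> R) (l rho'' x : R) :
  is_derive f x (s x * f x) -> is_derive s x (- v x) -> is_derive v x (v' x) ->
  is_derive rho x (rho' x) -> is_derive rho' x rho'' ->
  is_derive (fun y => boundary_flux l (s y) (v y) * f y * rho y ^ 6
                      - 4 * rho' y * rho y ^ 5 * v y ^ 2 * f y) x
    (f x * (defect l (v x) (v' x) * rho x ^ 6
       - ((defect_root l (s x) (v x) (v' x) ^ 2 + s x ^ 6 / 45) * rho x ^ 6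
          + 2 / 3 * (30 * rho x ^ 4 * rho' x ^ 2 + 6 * rho'' * rho x ^ 5) * v x ^ 2
          + 6 * rho' x * (rho x ^ 5 * cutoff_remainder l (s x) (v x)
                            (defect_root l (s x) (v x) (v' x)))))).
Proof.
  intros Hf Hs Hv Hr Hr'. unfold boundary_flux, defect, defect_root, cutoff_remainder.
  auto_derive.
  - repeat match goal with |- _ /\ _ => split end; try exact I; eexists; eassumption.
  - change (fun x0 : R => f x0) with f. change (fun x0 : R => s x0) with s.
    change (fun x0 : R => v x0) with v. change (fun x0 : R => rho x0) with rho.
    change (fun x0 : R => rho' x0) with rho'.
    rewrite (is_derive_unique _ _ _ Hf), (is_derive_unique _ _ _ Hs), (is_derive_unique _ _ _ Hv),
      (is_derive_unique _ _ _ Hr), (is_derive_unique _ _ _ Hr').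
    field.
Qed.

(** The integrand dominates the exact derivative [F'] of the cut-off flux, and [F'] integrates to 0
    because the cutoff vanishes at both endpoints. The condition on [r] lets the share [1 / 45] of
    [s ^ 6] absorb the remainder, whose coefficient is 12: [540 = 12 * 45]. What is not absorbed has
    coefficient at most [20 = 8 + 12]. *)
Lemma cutoff_defect_nonneg (f s v v' : R -> R) (l r : R) :
  (forall x, 0 < f x) ->
  (forall x, is_derive f x (s x * f x)) ->
  (forall x, is_derive s x (- v x)) ->
  (forall x, is_derive v x (v' x)) ->
  (forall x, continuous v' x) ->
  1 <= r -> 540 * (1 + Rabs l + l ^ 2) <= r ->
  0 <= RInt (fun x => defect l (v x) (v' x) * f x * (1 - (x / r) ^ 2) ^ 6
                      + 20 * (1 + Rabs l + l ^ 2) / r * (f x + v x ^ 2 * f x)) (- r) r.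
Proof.
  intros Hpos Hf Hs Hv Hv' Hr1 Hr.
  assert (Cf : forall x, continuous f x) by (intros x; apply ex_derive_continuous_R; eexists; apply Hf).
  assert (Cs : forall x, continuous s x) by (intros x; apply ex_derive_continuous_R; eexists; apply Hs).
  assert (Cv : forall x, continuous v x) by (intros x; apply ex_derive_continuous_R; eexists; apply Hv).
  set (h := / r). set (K := 1 + Rabs l + l ^ 2) in *.
  assert (HK : 1 <= K). { unfold K. assert (A1 := Rabs_pos l). assert (A2 := pow2_ge_0 l). lra. }
  assert (Hh : 0 < h) by (apply Rinv_0_lt_compat; lra).
  assert (Hrh : r * h = 1) by (apply Rinv_r; lra).
  assert (Hh1 : h <= 1) by nra.
  assert (HKh : 540 * (K * h) <= 1) by nra.
  set (rho := fun x => 1 - (x * h) ^ 2).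
  set (rho' := fun x => - 2 * x * h ^ 2).
  set (w := fun x => defect_root l (s x) (v x) (v' x)).
  set (F := fun y => boundary_flux l (s y) (v y) * f y * rho y ^ 6
                      - 4 * rho' y * rho y ^ 5 * v y ^ 2 * f y).
  set (F' := fun x => f x * (defect l (v x) (v' x) * rho x ^ 6
       - ((w x ^ 2 + s x ^ 6 / 45) * rho x ^ 6
          + 2 / 3 * (30 * rho x ^ 4 * rho' x ^ 2 + 6 * (- 2 * h ^ 2) * rho x ^ 5) * v x ^ 2
          + 6 * rho' x * (rho x ^ 5 * cutoff_remainder l (s x) (v x) (w x))))).
  assert (DF : forall x, is_derive F x (F' x)).
  { intros x. apply is_derive_cutoff_flux; auto.
    - unfold rho, rho'. auto_derive. auto. ring.
    - unfold rho'. auto_derive. auto. ring. }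
  assert (CF : forall x, continuous F' x).
  { intros x. unfold F', defect, w, defect_root, cutoff_remainder, rho, rho'. cont. }
  assert (I0 : is_RInt F' (- r) r 0).
  { replace 0 with (F r - F (- r)).
    - apply (is_RInt_derive F F'); intros; auto.
    - unfold F, rho. replace (- r * h) with (- 1) by lra. rewrite Hrh. ring. }
  apply (is_RInt_le F' (fun x => defect l (v x) (v' x) * f x * (1 - (x / r) ^ 2) ^ 6
                      + 20 * K / r * (f x + v x ^ 2 * f x)) (- r) r); try assumption.
  - lra.
  - apply (RInt_correct (V := R_CompleteNormedModule)), ex_RInt_cont.
    intros x. unfold defect. unfold Rdiv. cont.
  - intros x Hx. unfold Rdiv. fold h. unfold F'.
    assert (Hxh : - 1 <= x * h <= 1) by nra.
    assert (Hrho : 0 <= rho x <= 1) by (unfold rho; nra).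
    assert (B := cutoff_remainder_bound l (s x) (v x) (w x) (rho x) Hrho). fold K in B.
    change (1 - (x * h) ^ 2) with (rho x).
    set (p := rho x) in *.
    unfold cutoff_remainder. set (E := p ^ 5 * _) in *.
    unfold rho'.
    (* The positive factor [f x] is divided out. *)
    cut (- (20 * K * h * (1 + v x ^ 2)) <= (w x ^ 2 + s x ^ 6 / 45) * p ^ 6 +
      2 / 3 * (30 * p ^ 4 * (- 2 * x * h ^ 2) ^ 2 + 6 * (- 2 * h ^ 2) * p ^ 5) * v x ^ 2 + 6 * (- 2 * x * h ^ 2) * E).
    { intros HH. apply (Rmult_le_compat_l _ _ _ (Rlt_le _ _ (Hpos x))) in HH.
      set (Y := _ + 6 * (- 2 * x * h ^ 2) * E) in *. clearbody Y. lra. }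
    clearbody p.
    assert (V2 := pow2_ge_0 (v x)). 
    assert (R5 : 0 <= p ^ 5 <= 1). { assert (H5 := pow_incr _ _ 5 Hrho). rewrite pow1 in H5. split. apply pow_le; lra. exact H5. }
    assert (R4 : 0 <= p ^ 4) by (apply pow_le; lra).
    (* Only the summand with the second derivative of the cutoff is negative; [8 = 2 / 3 * 6 * 2],
       and [h <= 1] reduces [h ^ 2] to [h]. *)
    assert (T1 : - (8 * h * v x ^ 2) <= 2 / 3 * (30 * p ^ 4 * (- 2 * x * h ^ 2) ^ 2 + 6 * (- 2 * h ^ 2) * p ^ 5) * v x ^ 2).
    { assert (0 <= p ^ 4 * (- 2 * x * h ^ 2) ^ 2) by (apply Rmult_le_pos; [lra | apply pow2_ge_0]).
      assert (h ^ 2 * p ^ 5 <= h) by nra. nra. }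
    (* The slope of the cutoff is at most [2 * h] in absolute value, since [x * h] lies in
       [[-1, 1]]; this gives [12 = 6 * 2]. *)
    assert (T2 : - (6 * (- 2 * x * h ^ 2) * E) <= 12 * h * (K * (w x ^ 2 * p ^ 6 + s x ^ 6 * p ^ 6 + v x ^ 2 + 1))).
    { replace (- (6 * (- 2 * x * h ^ 2) * E)) with (12 * h * ((x * h) * E)) by ring.
      apply Rmult_le_compat_l. lra. eapply Rle_trans; [apply Rle_abs|]. rewrite Rabs_mult.
      assert (Rabs (x * h) <= 1) by (apply Rabs_le; split; lra).
      assert (HE := Rabs_pos E). nra. }
    assert (W : 0 <= w x ^ 2 * p ^ 6). { apply Rmult_le_pos. apply pow2_ge_0. apply pow_le; lra. }
    assert (S : 0 <= s x ^ 6 * p ^ 6).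
    { replace (s x ^ 6) with ((s x ^ 3) ^ 2) by ring. apply Rmult_le_pos. apply pow2_ge_0. apply pow_le; lra. }
    set (a := w x ^ 2 * p ^ 6) in *. set (b := s x ^ 6 * p ^ 6) in *.
    replace ((w x ^ 2 + s x ^ 6 / 45) * p ^ 6) with (a + b / 45) by (unfold a, b; field).
    assert (540 * (K * h) * a <= 1 * a) by (apply Rmult_le_compat_r; lra).
    assert (540 * (K * h) * b <= 1 * b) by (apply Rmult_le_compat_r; lra).
    assert (h * v x ^ 2 * 1 <= h * v x ^ 2 * K) by (apply Rmult_le_compat_l; nra).
    assert (0 <= K * h) by nra.
    lra.
Qed.

(** * The lower bound for admissible densities *)

Lemma smooth_is_derive (f : R -> R) : smooth f ->
  forall n x, is_derive (Derive_n f n) x (Derive_n f (S n) x).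
Proof. intros Hf n x. apply (Derive_correct (Derive_n f n) x). exact (Hf (S n) x). Qed.

(** The first three derivatives of [ln f] are polynomials in those of [f] divided by powers of [f],
    so smoothness and positivity supply all the regularity that the cut-off inequality asks for. *)
Lemma log_derivatives (f : R -> R) : smooth f -> (forall x, 0 < f x) ->
  exists s : R -> R,
    (forall x, is_derive f x (s x * f x)) /\
    (forall x, is_derive s x (- Hf f x)) /\
    (forall x, is_derive (Hf f) x (Derive (Hf f) x)) /\
    (forall x, continuous (Derive (Hf f)) x).
Proof.
  intros Hs Hpos.
  assert (D := smooth_is_derive f Hs).
  set (f1 := Derive_n f 1). set (f2 := Derive_n f 2). set (f3 := Derive_n f 3).
  assert (D0 : forall x, is_derive f x (f1 x)) by (exact (D 0%nat)).
  assert (D1 : forall x, is_derive f1 x (f2 x)) by (exact (D 1%nat)).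
  assert (D2 : forall x, is_derive f2 x (f3 x)) by (exact (D 2%nat)).
  assert (C3 : forall x, continuous f3 x).
  { intros x. apply ex_derive_continuous_R. eexists. exact (D 3%nat x). }
  clearbody f1 f2 f3.
  assert (NZ : forall x, f x <> 0) by (intros x; specialize (Hpos x); lra).
  set (s := fun x => f1 x / f x).
  assert (L1 : forall x, is_derive (fun y => ln (f y)) x (s x)).
  { intros x. unfold s. auto_derive.
    - split. eexists; apply D0. split. apply Hpos. exact I.
    - change (fun x0 : R => f x0) with f. rewrite (is_derive_unique _ _ _ (D0 x)). field. apply NZ. }
  assert (Ds : forall x, is_derive s x (f2 x / f x - (f1 x / f x) ^ 2)).
  { intros x. unfold s. auto_derive.
    - split. eexists; apply D1. split. eexists; apply D0. split. apply NZ. exact I.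
    - change (fun x0 : R => f x0) with f. change (fun x0 : R => f1 x0) with f1.
      rewrite (is_derive_unique _ _ _ (D0 x)), (is_derive_unique _ _ _ (D1 x)). field. apply NZ. }
  assert (EH : Hf f = fun x => (f1 x / f x) ^ 2 - f2 x / f x).
  { apply functional_extensionality. intros x. unfold Hf. simpl Derive_n.
    replace (fun y => Derive (fun x0 => ln (f x0)) y) with s.
    - change (fun x0 : R => s x0) with s. rewrite (is_derive_unique _ _ _ (Ds x)). ring.
    - apply functional_extensionality. intros y. symmetry. apply is_derive_unique, L1. }
  set (v' := fun x => 2 * (f1 x / f x) * (f2 x / f x - (f1 x / f x) ^ 2)
                      - (f3 x / f x - f2 x * f1 x / f x ^ 2)).
  assert (Dq : forall x, is_derive (fun y => f2 y / f y) x (f3 x / f x - f2 x * f1 x / f x ^ 2)).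
  { intros x. auto_derive.
    - split. eexists; apply D2. split. eexists; apply D0. split. apply NZ. exact I.
    - change (fun x0 : R => f x0) with f. change (fun x0 : R => f2 x0) with f2.
      rewrite (is_derive_unique _ _ _ (D0 x)), (is_derive_unique _ _ _ (D2 x)). field. apply NZ. }
  assert (DH : forall x, is_derive (Hf f) x (v' x)).
  { intros x. rewrite EH. unfold v'.
    apply (is_derive_minus (V := R_NormedModule) (fun y => s y ^ 2) (fun y => f2 y / f y)); [|apply Dq].
    evar_last. apply (is_derive_pow s 2), Ds. simpl. unfold s. ring. }
  assert (EDH : Derive (Hf f) = v').
  { apply functional_extensionality. intros x. apply is_derive_unique, DH. }
  exists s. split; [|split; [|split]].
  - intros x. evar_last. apply D0. unfold s. field. apply NZ.
  - intros x. evar_last. apply Ds. rewrite EH. ring.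
  - intros x. rewrite EDH. apply DH.
  - assert (C0 : forall x, continuous f x) by (intros x; apply ex_derive_continuous_R; eexists; apply D0).
    assert (C1 : forall x, continuous f1 x) by (intros x; apply ex_derive_continuous_R; eexists; apply D1).
    assert (C2 : forall x, continuous f2 x) by (intros x; apply ex_derive_continuous_R; eexists; apply D2).
    (* Division becomes multiplication by a continuous [g], a shape that the tactic [cont] can
       follow. *)
    set (g := fun y => / f y).
    assert (Ci : forall x, continuous g x).
    { intros x. apply (continuous_comp f Rinv). apply C0. apply continuous_Rinv, NZ. }
    intros x. rewrite EDH.
    replace v' with (fun x => 2 * (f1 x * g x) * (f2 x * g x - (f1 x * g x) ^ 2)
                      - (f3 x * g x - f2 x * f1 x * g x ^ 2)).
    + clearbody g. cont.
    + apply functional_extensionality. intros y. unfold v', g. field. apply NZ.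
Qed.

(** The cut-off inequality is taken at [r = INR n] and passed to the limit. Its error is [K / n]
    times a quantity tending to [1 + Q_fun f], hence disappears; this is where integrability of [f]
    and of [Q_integrand f] absorbs the terms left over from the cutoff. *)
Lemma heat_flow_quadratic_nonneg (f : R -> R) (l : R) : admissible f ->
  0 <= D_fun f - 2 * l * Q_fun f + l ^ 2 * I_fun f.
Proof.
  intros [Hs [Hpos [_ [H1 [HI [HQ [HD _]]]]]]].
  destruct (log_derivatives f Hs Hpos) as [s [Df [Ds [Dv Cv']]]].
  set (v := Hf f) in *. set (v' := Derive v) in *.
  assert (Cf : forall x, continuous f x) by (intros x; apply ex_derive_continuous_R; eexists; apply Df).
  assert (Cv : forall x, continuous v x) by (intros x; apply ex_derive_continuous_R; eexists; apply Dv).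
  set (gI := fun x => v x * f x). set (gQ := fun x => v x ^ 2 * f x).
  set (gD := fun x => (v' x ^ 2 + 2 * v x ^ 3) * f x).
  assert (CI : forall x, continuous gI x) by (intros x; unfold gI; cont).
  assert (CQ : forall x, continuous gQ x) by (intros x; unfold gQ; cont).
  assert (CD : forall x, continuous gD x) by (intros x; unfold gD; cont).
  assert (LI := cutoff_integral_lim gI CI HI).
  assert (LQ := cutoff_integral_lim gQ CQ HQ).
  assert (LD := cutoff_integral_lim gD CD HD).
  assert (L1 := is_RInt_gen_seq f 1 H1).
  assert (LQ' := is_RInt_gen_seq gQ _ (is_RInt_gen_integral_R gQ HQ)).
  set (K := 20 * (1 + Rabs l + l ^ 2)).
  assert (LK : is_lim_seq (fun n => K * / INR n) 0).
  { replace 0 with (K * 0) by ring. apply (is_lim_seq_scal_l _ K 0).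
    apply (is_lim_seq_inv _ p_infty). apply is_lim_seq_INR. discriminate. }
  assert (LL := is_lim_seq_plus' _ _ _ _
    (is_lim_seq_plus' _ _ _ _ (is_lim_seq_minus' _ _ _ _ LD (is_lim_seq_scal_l _ (2 * l) _ LQ))
       (is_lim_seq_scal_l _ (l ^ 2) _ LI))
    (is_lim_seq_mult' _ _ _ _ LK (is_lim_seq_plus' _ _ _ _ L1 LQ'))).
  assert (HL : Rbar_le 0 (integral_R gD - 2 * l * integral_R gQ + l ^ 2 * integral_R gI
            + 0 * (1 + integral_R gQ))).
  { destruct (nfloor_ex (540 * (1 + Rabs l + l ^ 2))) as [N [_ HN]].
    { assert (A1 := Rabs_pos l). assert (A2 := pow2_ge_0 l). lra. }
    refine (is_lim_seq_le_loc (fun _ => 0) _ 0 _ _ (is_lim_seq_const 0) LL).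
    exists (S N). intros n Hn.
    assert (HnN : 540 * (1 + Rabs l + l ^ 2) <= INR n).
    { apply le_INR in Hn. rewrite S_INR in Hn. lra. }
    assert (Hn1 : 1 <= INR n).
    { assert (A1 := Rabs_pos l). assert (A2 := pow2_ge_0 l). lra. }
    eapply Rle_trans.
    { apply (cutoff_defect_nonneg f s v v' l (INR n)); assumption. }
    right. set (r := INR n) in *. fold K.
    rewrite <- (RInt_plus_R f gQ), <- (RInt_scal_R _ (2 * l)), <- (RInt_scal_R _ (l ^ 2)),
      <- (RInt_scal_R (fun x => f x + gQ x) (K * / r)).
    all: try (intros x; unfold gI, gQ, gD; cont).
    assert (RM : forall g1 g2 : R -> R, (forall x, continuous g1 x) -> (forall x, continuous g2 x) ->
      RInt g1 (- r) r - RInt g2 (- r) r = RInt (fun x => g1 x - g2 x) (- r) r).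
    { intros g1 g2 K1 K2. symmetry. apply (RInt_minus (V := R_CompleteNormedModule)); apply ex_RInt_cont; assumption. }
    rewrite RM, <- !RInt_plus_R.
    all: try (intros x; unfold gI, gQ, gD; cont).
    apply RInt_ext. intros x _. match goal with |- @eq _ ?a ?b => change (@eq R a b) end. unfold defect, gI, gQ, gD, Rdiv. ring. }
  simpl in HL.
  change (D_fun f) with (integral_R gD). change (Q_fun f) with (integral_R gQ).
  change (I_fun f) with (integral_R gI). lra.
Qed.

Lemma Q_sqr_le_I_mult_D (f : R -> R) : admissible f ->
  0 < I_fun f /\ Q_fun f ^ 2 <= I_fun f * D_fun f.
Proof.
  intros Hf. assert (H := fun l => heat_flow_quadratic_nonneg f l Hf).
  destruct Hf as [_ [_ [_ [_ [_ [_ [_ HQ]]]]]]].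
  set (i := I_fun f) in *. set (q := Q_fun f) in *. set (d := D_fun f) in *.
  assert (Hi : 0 < i).
  { destruct (Rlt_dec 0 i) as [Hi|Hi]; [exact Hi|exfalso].
    (* At this [l] the linear term equals [- 2 * (Rabs d + 1)], too negative for [d] to compensate;
       if [i <= 0], the quadratic would be negative. *)
    specialize (H ((Rabs d + 1) / q)).
    assert (Hd := Rle_abs d).
    assert (E : 2 * ((Rabs d + 1) / q) * q = 2 * (Rabs d + 1)) by (field; lra).
    assert (0 <= ((Rabs d + 1) / q) ^ 2) by apply pow2_ge_0.
    assert (Hd' := Rabs_pos d). nra. }
  split; [exact Hi|].
  (* The minimiser of the quadratic in [l]. *)
  specialize (H (q / i)).
  replace (d - 2 * (q / i) * q + (q / i) ^ 2 * i) with ((i * d - q ^ 2) / i) in H by (field; lra).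
  apply Rmult_le_compat_r with (r := i) in H; [|lra].
  unfold Rdiv in H. rewrite Rmult_assoc, Rinv_l, Rmult_1_r, Rmult_0_l in H by lra. lra.
Qed.

Lemma ratio_set_ge_1 r : ratio_set r -> 1 <= r.
Proof.
  intros [f [Hf ->]]. destruct (Q_sqr_le_I_mult_D f Hf) as [_ H].
  destruct Hf as [_ [_ [_ [_ [_ [_ [_ HQ]]]]]]].
  apply Rle_div_r. apply pow_lt, HQ. lra.
Qed.

(** * Polynomials in [x], [sin x], [cos x] against the perturbed Gaussian weight *)

(* A syntax for the polynomials in x, sin x and cos x, closed under differentiation. *)
Inductive texpr : Type :=
  | Cst (r : R) | Var | Sin | Cos
  | Add (p q : texpr) | Mul (p q : texpr).

Fixpoint ev (p : texpr) (x : R) : R :=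
  match p with
  | Cst r => r
  | Var => x
  | Sin => sin x
  | Cos => cos x
  | Add p q => ev p x + ev q x
  | Mul p q => ev p x * ev q x
  end.

Fixpoint dv (p : texpr) : texpr :=
  match p with
  | Cst _ => Cst 0
  | Var => Cst 1
  | Sin => Cos
  | Cos => Mul (Cst (-1)) Sin
  | Add p q => Add (dv p) (dv q)
  | Mul p q => Add (Mul (dv p) q) (Mul p (dv q))
  end.

Lemma is_derive_ev p x : is_derive (ev p) x (ev (dv p) x).
Proof.
  induction p; simpl.
  - apply (is_derive_const (V := R_NormedModule)).
  - apply (is_derive_id (K := R_AbsRing)).
  - apply is_derive_sin.
  - evar_last. apply is_derive_cos. ring.
  - apply (is_derive_plus (V := R_NormedModule)); assumption.
  - evar_last. apply (is_derive_mult (K := R_AbsRing)); try eassumption. intros; apply Rmult_comm.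
    unfold plus, mult; simpl. ring.
Qed.

(** The base [1 + x ^ 2] is at least 1, so the two exponents of a sum may both be raised to
    [n1 + n2]. *)
Lemma ev_growth p : exists C n, 0 <= C /\ forall x, Rabs (ev p x) <= C * (1 + x ^ 2) ^ n.
Proof.
  induction p as [r| | | |p [C1 [n1 [H1 K1]]] q [C2 [n2 [H2 K2]]]|p [C1 [n1 [H1 K1]]] q [C2 [n2 [H2 K2]]]]; simpl ev.
  - exists (Rabs r), 0%nat. split. apply Rabs_pos. intros x. simpl. lra.
  - exists 1, 1%nat. split. lra. intros x. rewrite pow_1. apply Rabs_le. nra.
  - exists 1, 0%nat. split. lra. intros x. simpl. assert (H := SIN_bound x). apply Rabs_le. lra.
  - exists 1, 0%nat. split. lra. intros x. simpl. assert (H := COS_bound x). apply Rabs_le. lra.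
  - exists (C1 + C2), (n1 + n2)%nat. split. lra. intros x.
    specialize (K1 x). specialize (K2 x).
    assert (Hy : 1 <= 1 + x ^ 2) by (assert (H := pow2_ge_0 x); lra).
    eapply Rle_trans. apply Rabs_triang.
    assert (A1 : C1 * (1 + x ^ 2) ^ n1 <= C1 * (1 + x ^ 2) ^ (n1 + n2)).
    { apply Rmult_le_compat_l. exact H1. apply Rle_pow. exact Hy. lia. }
    assert (A2 : C2 * (1 + x ^ 2) ^ n2 <= C2 * (1 + x ^ 2) ^ (n1 + n2)).
    { apply Rmult_le_compat_l. exact H2. apply Rle_pow. exact Hy. lia. }
    lra.
  - exists (C1 * C2), (n1 + n2)%nat. split. apply Rmult_le_pos; assumption. intros x.
    rewrite Rabs_mult, pow_add.
    replace (C1 * C2 * ((1 + x ^ 2) ^ n1 * (1 + x ^ 2) ^ n2)) with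
      ((C1 * (1 + x ^ 2) ^ n1) * (C2 * (1 + x ^ 2) ^ n2)) by ring.
    apply Rmult_le_compat; auto using Rabs_pos.
Qed.

Definition weight (d e x : R) : R := exp (- d * x ^ 2 / 2 + e * cos x).

Definition wmul (d e : R) (p : texpr) (x : R) : R := ev p x * weight d e x.

Definition drift (d e : R) : texpr := Add (Mul (Cst (- d)) Var) (Mul (Cst (- e)) Sin).

(** Differentiation conjugated by the weight: [(p * w)' = (p' + p * u') * w], where [u' = drift] is
    the derivative of the logarithm of the weight [w]. *)
Definition twisted_dv (d e : R) (p : texpr) : texpr := Add (dv p) (Mul p (drift d e)).

Lemma is_derive_wmul d e p x : is_derive (wmul d e p) x (wmul d e (twisted_dv d e p) x).
Proof.
  assert (Hw : is_derive (weight d e) x (ev (drift d e) x * weight d e x)).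
  { unfold weight. auto_derive. exact I. simpl. unfold Rdiv. field. }
  unfold wmul. evar_last.
  - apply (is_derive_mult (K := R_AbsRing) (ev p) (weight d e)).
    + apply is_derive_ev.
    + exact Hw.
    + intros; apply Rmult_comm.
  - unfold plus, mult; simpl. ring.
Qed.

Lemma continuous_wmul d e p x : continuous (wmul d e p) x.
Proof. apply ex_derive_continuous_R. eexists. apply is_derive_wmul. Qed.

Lemma exp_le_mono a b : a <= b -> exp a <= exp b.
Proof. intros [H|H]; [left; apply exp_increasing, H | right; rewrite H; reflexivity]. Qed.

Lemma exp_INR_mult n y : exp y ^ n = exp (INR n * y).
Proof.
  induction n.
  - simpl. rewrite Rmult_0_l, exp_0. reflexivity.
  - rewrite S_INR. simpl pow. rewrite IHn, <- exp_plus. f_equal. ring.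
Qed.

Lemma pow_le_exp n c y : 0 < c -> 0 <= y -> y ^ n <= (/ c) ^ n * exp (INR n * (c * y)).
Proof.
  intros Hc Hy. rewrite <- exp_INR_mult, <- Rpow_mult_distr. apply pow_incr. split. exact Hy.
  assert (H := exp_ineq1_le (c * y)).
  apply Rle_trans with (/ c * (c * y)).
  - right. field. lra.
  - apply Rmult_le_compat_l. apply Rlt_le, Rinv_0_lt_compat, Hc. lra.
Qed.

Lemma weight_pos d e x : 0 < weight d e x.
Proof. apply exp_pos. Qed.

Lemma wmul_bound d e p : 0 < d -> exists C, 0 <= C /\ forall x, Rabs (wmul d e p x) <= C / (1 + x ^ 2).
Proof.
  intros Hd. destruct (ev_growth p) as [C [n [HC HB]]].
  (* Chosen so that [INR (S n) * c = d / 2], the rate of the Gaussian. One power more than the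
     growth [n] is spent, to leave the decay [1 / (1 + x ^ 2)]. *)
  set (c := d / (2 * INR (S n))).
  assert (Hn : 0 < INR (S n)) by (apply lt_0_INR; lia).
  assert (Hc : 0 < c) by (apply Rdiv_lt_0_compat; lra).
  set (B := (/ c) ^ S n * exp (d / 2 + Rabs e)).
  assert (HB0 : 0 <= B).
  { apply Rmult_le_pos. apply pow_le, Rlt_le, Rinv_0_lt_compat, Hc. apply Rlt_le, exp_pos. }
  exists (C * B). split. apply Rmult_le_pos; assumption.
  intros x. set (y := 1 + x ^ 2).
  assert (Hy : 1 <= y) by (unfold y; assert (H := pow2_ge_0 x); lra).
  unfold wmul. rewrite Rabs_mult, (Rabs_pos_eq (weight d e x)) by apply Rlt_le, weight_pos.
  apply (proj1 (Rle_div_r _ _ _ (Rlt_le_trans _ _ _ Rlt_0_1 Hy))).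
  assert (K : y ^ S n * weight d e x <= B).
  { apply Rle_trans with ((/ c) ^ S n * exp (INR (S n) * (c * y)) * weight d e x).
    - apply Rmult_le_compat_r. apply Rlt_le, weight_pos. apply pow_le_exp; lra.
    - unfold B. rewrite Rmult_assoc. apply Rmult_le_compat_l.
      apply pow_le, Rlt_le, Rinv_0_lt_compat, Hc.
      unfold weight. rewrite <- exp_plus.
      assert (E : INR (S n) * (c * y) = d * y / 2) by (unfold c; field; lra).
      assert (He : e * cos x <= Rabs e).
      { eapply Rle_trans. apply Rle_abs. rewrite Rabs_mult.
        assert (Rabs (cos x) <= 1) by (apply Rabs_le, COS_bound).
        assert (H0 := Rabs_pos e). nra. }
      apply exp_le_mono. rewrite E. unfold y. lra. }
  apply Rle_trans with (C * (y ^ S n * weight d e x)).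
  - simpl pow. replace (C * (y * y ^ n * weight d e x)) with (C * y ^ n * weight d e x * y) by ring.
    apply Rmult_le_compat_r. lra. apply Rmult_le_compat_r. apply Rlt_le, weight_pos. apply HB.
  - apply Rmult_le_compat_l; assumption.
Qed.

Lemma wmul_integrable d e p : 0 < d -> whole_line_integrable (wmul d e p).
Proof.
  intros Hd. destruct (wmul_bound d e p Hd) as [C [_ HC]].
  apply (whole_line_integrable_bound _ C). apply continuous_wmul. exact HC.
Qed.

Lemma is_lim_of_bound (g : R -> R) C : 0 <= C -> (forall x, Rabs (g x) <= C / (1 + x ^ 2)) ->
  is_lim g p_infty 0 /\ is_lim g m_infty 0.
Proof.
  intros HC Hg.
  assert (K : forall eps, 0 < eps -> forall x, C / eps + 1 < Rabs x -> Rabs (g x - 0) < eps).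
  { intros eps He x Hx. rewrite Rminus_0_r. eapply Rle_lt_trans; [apply Hg|].
    assert (0 <= C / eps) by (apply Rmult_le_pos; [exact HC | apply Rlt_le, Rinv_0_lt_compat, He]).
    rewrite <- pow2_abs. apply Rlt_div_l. nra.
    assert (H1 : C / eps < 1 + Rabs x ^ 2) by nra.
    apply Rlt_div_l in H1. lra. exact He. }
  split; apply is_lim_spec; intros [eps He]; simpl.
  - exists (C / eps + 1). intros x Hx. apply K. exact He. eapply Rlt_le_trans. apply Hx. apply Rle_abs.
  - exists (- (C / eps + 1)). intros x Hx. apply K. exact He.
    rewrite <- Rabs_Ropp. eapply Rlt_le_trans; [|apply Rle_abs]. lra.
Qed.

Lemma wmul_lim d e p : 0 < d -> is_lim (wmul d e p) p_infty 0 /\ is_lim (wmul d e p) m_infty 0.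
Proof.
  intros Hd. destruct (wmul_bound d e p Hd) as [C [HC0 HC]].
  exact (is_lim_of_bound _ C HC0 HC).
Qed.

Lemma integral_R_unique (g : R -> R) (l : R) :
  is_RInt_gen g (Rbar_locally m_infty) (Rbar_locally p_infty) l -> integral_R g = l.
Proof. intros H. exact (is_RInt_gen_unique (V := R_CompleteNormedModule) g l H). Qed.

Lemma integral_R_le (g h : R -> R) :
  (forall x, continuous g x) -> (forall x, continuous h x) ->
  whole_line_integrable g -> whole_line_integrable h ->
  (forall x, g x <= h x) -> integral_R g <= integral_R h.
Proof.
  intros Cg Ch Hg Hh Hle.
  apply is_RInt_gen_integral_R, is_RInt_gen_seq in Hg.
  apply is_RInt_gen_integral_R, is_RInt_gen_seq in Hh.
  refine (is_lim_seq_le _ _ (Finite _) (Finite _) _ Hg Hh).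
  intros n. apply RInt_le; try (apply ex_RInt_cont; assumption).
  - assert (H := pos_INR n). lra.
  - intros x _. apply Hle.
Qed.

Lemma integral_R_lin (g h : R -> R) k :
  whole_line_integrable g -> whole_line_integrable h ->
  integral_R (fun x => g x + k * h x) = integral_R g + k * integral_R h.
Proof.
  intros Hg Hh. apply integral_R_unique.
  apply (is_RInt_gen_plus (V := R_NormedModule) g (fun x => k * h x)).
  - apply is_RInt_gen_integral_R, Hg.
  - apply (is_RInt_gen_scal (V := R_NormedModule) h k), is_RInt_gen_integral_R, Hh.
Qed.

(** * Moments of the weight and integration by parts *)

Definition moment (d e : R) (p : texpr) : R := integral_R (wmul d e p).

Lemma moment_ext d e p q : (forall x, ev p x = ev q x) -> moment d e p = moment d e q.
Proof.
  intros H. unfold moment. f_equal. apply functional_extensionality. intros x.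
  unfold wmul. rewrite H. reflexivity.
Qed.

Lemma moment_le d e p q : 0 < d -> (forall x, ev p x <= ev q x) -> moment d e p <= moment d e q.
Proof.
  intros Hd H. apply integral_R_le; try apply continuous_wmul; try (apply wmul_integrable, Hd).
  intros x. apply Rmult_le_compat_r. apply Rlt_le, weight_pos. apply H.
Qed.

Lemma moment_lin d e p k q : 0 < d ->
  moment d e (Add p (Mul (Cst k) q)) = moment d e p + k * moment d e q.
Proof.
  intros Hd. unfold moment. rewrite <- integral_R_lin by (apply wmul_integrable, Hd).
  f_equal. apply functional_extensionality. intros x. unfold wmul. simpl. ring.
Qed.

(** Integration by parts without boundary terms: the integrand is the derivative of [wmul d e p],
    which vanishes at both ends. *)
Lemma moment_twisted_dv d e p : 0 < d -> moment d e (twisted_dv d e p) = 0.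
Proof.
  intros Hd. destruct (wmul_lim d e p Hd) as [Hp Hm].
  apply integral_R_unique. replace 0 with (0 - 0) by ring.
  apply (is_RInt_gen_primitive (wmul d e p)); try assumption.
  - intros x. apply is_derive_wmul.
  - intros x. apply continuous_wmul.
Qed.

Lemma moment_1_pos d e : 0 < d -> 0 < moment d e (Cst 1).
Proof.
  intros Hd.
  set (m := RInt (wmul d e (Cst 1)) (- 1) 1).
  assert (Hm : 0 < m).
  { apply RInt_gt_0. lra. intros x _. unfold wmul. simpl. assert (H := weight_pos d e x). lra.
    intros x _. apply continuous_wmul. }
  apply Rlt_le_trans with m. exact Hm.
  assert (Hl := is_RInt_gen_seq _ _ (is_RInt_gen_integral_R _ (wmul_integrable d e (Cst 1) Hd))).
  refine (is_lim_seq_le_loc (fun _ => m) _ (Finite m) (Finite _) _ (is_lim_seq_const m) Hl).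
  exists 1%nat. intros n Hn. apply le_INR in Hn. simpl in Hn.
  assert (C := continuous_wmul d e (Cst 1)).
  assert (P : forall a b, a <= b -> 0 <= RInt (wmul d e (Cst 1)) a b).
  { intros a b Hab. apply RInt_ge_0. exact Hab. apply ex_RInt_cont, C.
    intros x _. unfold wmul. simpl. assert (H := weight_pos d e x). lra. }
  rewrite <- (RInt_Chasles_R _ (- INR n) (- 1) (INR n) C), <- (RInt_Chasles_R _ (- 1) 1 (INR n) C).
  fold m. assert (H1 := P (- INR n) (- 1)). assert (H2 := P 1 (INR n)). lra.
Qed.

(* Comparison with the Gaussian weight [e = 0], whose second moment is explicit. *)
Lemma moment_sqr_le d e : 0 < d -> 0 <= e <= 1 ->
  d * moment d e (Mul Var Var) <= 9 * moment d e (Cst 1).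
Proof.
  intros Hd He.
  assert (Hw : forall x, exp (- e) * weight d 0 x <= weight d e x <= exp e * weight d 0 x).
  { intros x. unfold weight. rewrite <- !exp_plus.
    assert (H := COS_bound x). split; apply exp_le_mono; nra. }
  assert (G : d * moment d 0 (Mul Var Var) = moment d 0 (Cst 1)).
  { assert (H := moment_twisted_dv d 0 Var Hd).
    rewrite (moment_ext d 0 _ (Add (Cst 1) (Mul (Cst (- d)) (Mul Var Var)))) in H.
    - rewrite moment_lin in H by exact Hd. lra.
    - intros x. simpl. ring. }
  assert (Z : forall p, moment d 0 (Mul (Cst 0) p) = 0).
  { intros p. rewrite (moment_ext _ _ _ (Add (Cst 0) (Mul (Cst 0) p))) by (intros; simpl; ring).
    rewrite moment_lin by exact Hd.
    (* The twisted derivative of 0 is 0, which yields [moment d 0 (Cst 0) = 0]. *)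
    assert (T := moment_twisted_dv d 0 (Cst 0) Hd).
    rewrite (moment_ext _ _ _ (Cst 0)) in T by (intros; simpl; ring). lra. }
  assert (S : forall c p, moment d 0 (Mul (Cst c) p) = c * moment d 0 p).
  { intros c p. rewrite (moment_ext _ _ _ (Add (Mul (Cst 0) p) (Mul (Cst c) p))) by (intros; simpl; ring).
    rewrite moment_lin, Z by exact Hd. ring. }
  assert (U : moment d e (Mul Var Var) <= exp e * moment d 0 (Mul Var Var)).
  { rewrite <- S. apply integral_R_le; try apply continuous_wmul; try (apply wmul_integrable, Hd).
    intros x. unfold wmul. simpl. destruct (Hw x) as [_ H]. assert (H0 := pow2_ge_0 x). nra. }
  assert (L : exp (- e) * moment d 0 (Cst 1) <= moment d e (Cst 1)).
  { rewrite <- S. apply integral_R_le; try apply continuous_wmul; try (apply wmul_integrable, Hd).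
    intros x. unfold wmul. simpl. destruct (Hw x) as [H _]. lra. }
  assert (Ee : exp (- e) * exp e = 1) by (rewrite <- exp_plus, Rplus_opp_l; apply exp_0).
  (* Each of the comparisons [U] and [M0] costs a factor [exp e]; hence the constant [9 = 3 ^ 2]. *)
  assert (E3 : exp e <= 3) by (eapply Rle_trans; [apply exp_le_mono, He | apply exp_le_3]).
  assert (P := moment_1_pos d 0 Hd). assert (Pe := moment_1_pos d e Hd).
  assert (E0 := exp_pos e). assert (E0' := exp_pos (- e)).
  assert (M0 : moment d 0 (Cst 1) <= exp e * moment d e (Cst 1)).
  { apply Rmult_le_compat_l with (r := exp e) in L; [|lra].
    rewrite <- Rmult_assoc, (Rmult_comm (exp e)), Ee in L. lra. }
  apply Rle_trans with (exp e * moment d 0 (Cst 1)); nra.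
Qed.

(** * The normalised density: admissibility and expectations *)

Definition density (d e x : R) : R := weight d e x / moment d e (Cst 1).

Definition mean (d e : R) (p : texpr) : R := moment d e p / moment d e (Cst 1).

Section Density.
Variables d e : R.
Hypothesis Hd : 0 < d.

Lemma ev_density p x : ev p x * density d e x = / moment d e (Cst 1) * wmul d e p x.
Proof. unfold density, wmul, Rdiv. ring. Qed.

Lemma is_RInt_gen_density p :
  is_RInt_gen (fun x => ev p x * density d e x) (Rbar_locally m_infty) (Rbar_locally p_infty) (mean d e p).
Proof.
  replace (fun x => ev p x * density d e x) with (fun x => / moment d e (Cst 1) * wmul d e p x)
    by (apply functional_extensionality; intros; symmetry; apply ev_density).
  unfold mean, Rdiv. rewrite Rmult_comm.
  apply (is_RInt_gen_scal (V := R_NormedModule) (wmul d e p) (/ moment d e (Cst 1))).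
  apply is_RInt_gen_integral_R, wmul_integrable, Hd.
Qed.

Lemma density_integrable p : whole_line_integrable (fun x => ev p x * density d e x).
Proof.
  split; [eexists; apply is_RInt_gen_density|].
  destruct (wmul_integrable d e p Hd) as [_ [l Hl]].
  exists (/ moment d e (Cst 1) * l).
  replace (fun x => Rabs (ev p x * density d e x))
    with (fun x => / moment d e (Cst 1) * Rabs (wmul d e p x)).
  - apply (is_RInt_gen_scal (V := R_NormedModule) (fun x => Rabs (wmul d e p x))), Hl.
  - apply functional_extensionality. intros x. rewrite ev_density, Rabs_mult. f_equal.
    symmetry. apply Rabs_pos_eq, Rlt_le, Rinv_0_lt_compat, moment_1_pos, Hd.
Qed.

Lemma density_pos x : 0 < density d e x.
Proof. apply Rdiv_lt_0_compat. apply weight_pos. apply moment_1_pos, Hd. Qed.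

Lemma is_derive_ev_density p x :
  is_derive (fun y => ev p y * density d e y) x (ev (twisted_dv d e p) x * density d e x).
Proof.
  apply (is_derive_ext (fun x => / moment d e (Cst 1) * wmul d e p x)).
  { intros y. symmetry. apply ev_density. }
  rewrite ev_density.
  apply (is_derive_scal (wmul d e p)), is_derive_wmul.
Qed.

(** Derivatives stay in the class of a [texpr] times the density, which reduces smoothness and rapid
    decay to facts about [wmul]. *)
Lemma Derive_n_density n :
  Derive_n (density d e) n = fun x => ev (Nat.iter n (twisted_dv d e) (Cst 1)) x * density d e x.
Proof.
  induction n; apply functional_extensionality; intros x.
  - simpl. ring.
  - simpl. rewrite IHn. apply is_derive_unique, is_derive_ev_density.
Qed.

Lemma density_smooth : smooth (density d e).
Proof.
  intros [|n] x; simpl. exact I. rewrite Derive_n_density. eexists. apply is_derive_ev_density.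
Qed.

Lemma density_rapidly_decaying : rapidly_decaying (density d e).
Proof.
  intros n k. rewrite Derive_n_density.
  set (p := Nat.iter n (twisted_dv d e) (Cst 1)).
  set (q := Nat.iter k (Mul Var) p).
  assert (E : (fun x => x ^ k * (ev p x * density d e x)) = fun x => / moment d e (Cst 1) * wmul d e q x).
  { apply functional_extensionality. intros x. rewrite <- ev_density.
    assert (Q : ev q x = x ^ k * ev p x).
    { unfold q. clear q. induction k; simpl. ring. rewrite IHk. ring. }
    rewrite Q. ring. }
  rewrite E. destruct (wmul_lim d e q Hd) as [H1 H2].
  rewrite <- (Rmult_0_r (/ moment d e (Cst 1))).
  split.
  - apply (is_lim_scal_l (wmul d e q) _ p_infty 0 H1).
  - apply (is_lim_scal_l (wmul d e q) _ m_infty 0 H2).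
Qed.

Definition hess : texpr := Add (Cst d) (Mul (Cst e) Cos).

Lemma Hf_density : Hf (density d e) = ev hess.
Proof.
  apply functional_extensionality. intros x. unfold Hf. simpl Derive_n.
  replace (fun y => Derive (fun z => ln (density d e z)) y) with (fun y => - d * y - e * sin y).
  - evar_last. { apply f_equal. apply is_derive_unique. auto_derive. exact I. reflexivity. }
    simpl. ring.
  - apply functional_extensionality. intros y. symmetry. apply is_derive_unique.
    apply (is_derive_ext (fun z => - d * z ^ 2 / 2 + e * cos z - ln (moment d e (Cst 1)))).
    + intros z. unfold density, weight. rewrite ln_div, ln_exp. reflexivity.
      apply exp_pos. apply moment_1_pos, Hd.
    + auto_derive. exact I. field.
Qed.

Lemma I_integrand_density : I_integrand (density d e) = fun x => ev hess x * density d e x.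
Proof. unfold I_integrand. rewrite Hf_density. reflexivity. Qed.

Lemma Q_integrand_density :
  Q_integrand (density d e) = fun x => ev (Mul hess hess) x * density d e x.
Proof.
  unfold Q_integrand. rewrite Hf_density. apply functional_extensionality. intros x. simpl. ring.
Qed.

Definition D_expr : texpr :=
  Add (Mul (dv hess) (dv hess)) (Mul (Cst 2) (Mul hess (Mul hess hess))).

Lemma D_integrand_density : D_integrand (density d e) = fun x => ev D_expr x * density d e x.
Proof.
  unfold D_integrand. rewrite Hf_density. apply functional_extensionality. intros x.
  rewrite (is_derive_unique _ _ _ (is_derive_ev hess x)). simpl. ring.
Qed.

Lemma I_fun_density : I_fun (density d e) = mean d e hess.
Proof. unfold I_fun. rewrite I_integrand_density. apply integral_R_unique, is_RInt_gen_density. Qed.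

Lemma Q_fun_density : Q_fun (density d e) = mean d e (Mul hess hess).
Proof. unfold Q_fun. rewrite Q_integrand_density. apply integral_R_unique, is_RInt_gen_density. Qed.

Lemma D_fun_density : D_fun (density d e) = mean d e D_expr.
Proof. unfold D_fun. rewrite D_integrand_density. apply integral_R_unique, is_RInt_gen_density. Qed.

Lemma mean_1 : mean d e (Cst 1) = 1.
Proof. unfold mean. field. assert (H := moment_1_pos d e Hd). lra. Qed.

Lemma density_admissible : 0 < Q_fun (density d e) -> admissible (density d e).
Proof.
  intros HQ. split; [apply density_smooth|]. split; [apply density_pos|].
  split; [apply density_rapidly_decaying|]. split.
  { rewrite <- mean_1.
    replace (density d e) with (fun x => ev (Cst 1) x * density d e x)
      by (apply functional_extensionality; intros; simpl; ring).
    apply is_RInt_gen_density. }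
  rewrite I_integrand_density, Q_integrand_density, D_integrand_density.
  exact (conj (density_integrable _) (conj (density_integrable _) (conj (density_integrable _) HQ))).
Qed.

Lemma mean_ext p q : (forall x, ev p x = ev q x) -> mean d e p = mean d e q.
Proof. intros H. unfold mean. rewrite (moment_ext _ _ p q H). reflexivity. Qed.

Lemma mean_le p q : (forall x, ev p x <= ev q x) -> mean d e p <= mean d e q.
Proof.
  intros H. apply Rmult_le_compat_r. apply Rlt_le, Rinv_0_lt_compat, moment_1_pos, Hd.
  apply moment_le; assumption.
Qed.

Lemma mean_lin p k q : mean d e (Add p (Mul (Cst k) q)) = mean d e p + k * mean d e q.
Proof. unfold mean. rewrite moment_lin by exact Hd. unfold Rdiv. ring. Qed.

Lemma mean_Cst c : mean d e (Cst c) = c.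
Proof.
  rewrite (mean_ext _ (Add (Cst 1) (Mul (Cst (c - 1)) (Cst 1)))) by (intros; simpl; ring).
  rewrite mean_lin, mean_1. ring.
Qed.

Lemma mean_twisted_dv p : mean d e (twisted_dv d e p) = 0.
Proof. unfold mean. rewrite moment_twisted_dv by exact Hd. unfold Rdiv. ring. Qed.

Lemma mean_bounds p a b : (forall x, a <= ev p x <= b) -> a <= mean d e p <= b.
Proof.
  intros H. split.
  - rewrite <- (mean_Cst a). apply mean_le. intros x. apply H.
  - rewrite <- (mean_Cst b). apply mean_le. intros x. apply H.
Qed.

(* AM-GM: [d * |x| <= (k + d ^ 2 * x ^ 2 / k) / 2]. *)
Lemma mean_drift_abs p k : 0 < k -> 0 <= e <= 1 -> (forall x, Rabs (ev p x) <= 1) ->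
  d * Rabs (mean d e (Mul Var p)) <= (k + 9 * d / k) / 2.
Proof.
  intros Hk He Hp.
  assert (Hv : d * mean d e (Mul Var Var) <= 9).
  { assert (H := moment_sqr_le d e Hd He). assert (P := moment_1_pos d e Hd).
    unfold mean. unfold Rdiv. rewrite <- Rmult_assoc. apply (proj2 (Rle_div_l _ _ _ P)). exact H. }
  assert (Hk' := Rinv_0_lt_compat _ Hk).
  assert (Hx : forall x, Rabs (d * (x * ev p x)) <= (k + d ^ 2 * / k * x ^ 2) / 2).
  { intros x. rewrite <- Rmult_assoc, Rabs_mult.
    apply Rle_trans with (Rabs (d * x)).
    - specialize (Hp x). assert (H := Rabs_pos (d * x)). nra.
    - assert (Hs := pow2_ge_0 (Rabs (d * x) - k)).
      replace (d ^ 2 * / k * x ^ 2) with (Rabs (d * x) ^ 2 * / k) by (rewrite pow2_abs; ring).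
      set (a := Rabs (d * x)) in *.
      assert (H1 : 0 <= (a - k) ^ 2 * / k) by (apply Rmult_le_pos; lra).
      replace ((a - k) ^ 2 * / k) with (a ^ 2 * / k - 2 * a + k) in H1 by (field; lra).
      lra. }
  (* The pointwise majorant from AM-GM, written as a [texpr] so that its mean follows from the
     second moment. *)
  set (B := Add (Cst (k / 2)) (Mul (Cst (d ^ 2 * / k / 2)) (Mul Var Var))).
  assert (EB : mean d e B <= (k + 9 * d / k) / 2).
  { unfold B. rewrite mean_lin, mean_Cst.
    replace (d ^ 2 * / k / 2 * mean d e (Mul Var Var))
      with (d * / k / 2 * (d * mean d e (Mul Var Var))) by (field; lra).
    assert (H0 : 0 < d * / k / 2) by (apply Rmult_lt_0_compat; [nra | lra]).
    unfold Rdiv at 4. nra. }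
  rewrite <- (Rabs_pos_eq d) at 1 by lra. rewrite <- Rabs_mult.
  assert (S : forall c, c * mean d e (Mul Var p) = mean d e (Add (Cst 0) (Mul (Cst c) (Mul Var p)))).
  { intros c. rewrite mean_lin, mean_Cst. ring. }
  apply Rabs_le. split.
  - apply Ropp_le_cancel. rewrite Ropp_involutive.
    replace (- (d * mean d e (Mul Var p))) with (- d * mean d e (Mul Var p)) by ring.
    rewrite S. eapply Rle_trans; [|exact EB]. apply mean_le. intros x. simpl.
    specialize (Hx x). apply Rabs_le_between in Hx. lra.
  - rewrite S. eapply Rle_trans; [|exact EB]. apply mean_le. intros x. simpl.
    specialize (Hx x). apply Rabs_le_between in Hx. lra.
Qed.

End Density.

(** * A family whose ratio tends to 1, and the infimum *)

Lemma ratio_set_near_1 e : 0 < e <= 1 / 100 -> exists r, ratio_set r /\ r <= 1 + 50 * e.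
Proof.
  intros He. set (d := e ^ 4).
  assert (Hd : 0 < d) by (apply pow_lt; lra).
  set (E := mean d e).
  set (c1 := E Cos). set (c2 := E (Mul Cos Cos)). set (c3 := E (Mul Cos (Mul Cos Cos))).
  assert (Lin : forall p k q, E (Add p (Mul (Cst k) q)) = E p + k * E q) by (intros; apply mean_lin, Hd).
  assert (Ct : forall c, E (Cst c) = c) by (intros; apply mean_Cst, Hd).
  assert (Ibp : forall p, E (twisted_dv d e p) = 0) by (intros; apply mean_twisted_dv, Hd).
  assert (SC : forall x, sin x * sin x = 1 - cos x * cos x).
  { intros x. assert (H := sin2_cos2 x). unfold Rsqr in H. lra. }
  assert (Hsin : forall x, -1 <= sin x <= 1) by apply SIN_bound.
  assert (Hcos : forall x, -1 <= cos x <= 1) by apply COS_bound.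
  assert (Drift : forall p, (forall x, Rabs (ev p x) <= 1) -> - (5 * e ^ 2) <= d * E (Mul Var p) <= 5 * e ^ 2).
  { intros p Hp. assert (He2 : 0 < e ^ 2) by (apply pow_lt; lra).
    (* With [d = e ^ 4], the choice [k = e ^ 2] makes both AM-GM terms of order [e ^ 2]; their sum
       is [(1 + 9) / 2 * e ^ 2]. *)
    assert (H := mean_drift_abs d e Hd p (e ^ 2) He2 ltac:(lra) Hp).
    replace ((e ^ 2 + 9 * d / e ^ 2) / 2) with (5 * e ^ 2) in H by (unfold d; field; lra).
    apply Rabs_le_between. rewrite Rabs_mult, (Rabs_pos_eq d) by lra. exact H. }
  assert (B1 := Drift Sin ltac:(intros; apply Rabs_le, Hsin)).
  assert (B2 := Drift (Mul Sin Cos) ltac:(intros x; simpl; apply Rabs_le; specialize (Hsin x); specialize (Hcos x); split; nra)).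
  assert (Hsc2 : forall x, -1 <= sin x * (cos x * cos x) <= 1).
  { intros x. specialize (Hsin x). specialize (Hcos x).
    assert (0 <= cos x * cos x <= 1) by nra. split; nra. }
  assert (B3 := Drift (Mul Sin (Mul Cos Cos)) ltac:(intros x; simpl; apply Rabs_le, Hsc2)).
  assert (R2 : -1 <= E (Mul Cos (Mul Sin Sin)) <= 1).
  { apply mean_bounds. exact Hd. intros x. simpl. specialize (Hcos x). rewrite SC.
    assert (0 <= cos x * cos x <= 1) by nra. split; nra. }
  assert (R3 : -1 <= E (Mul (Mul Cos Cos) (Mul Sin Sin)) <= 1).
  { apply mean_bounds. exact Hd. intros x. simpl. specialize (Hcos x). rewrite SC.
    assert (0 <= cos x * cos x <= 1) by nra. split; nra. }
  (* Integration by parts against [sin], [sin * cos] and [sin * cos ^ 2] gives one equation for each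
     of [c1], [c2], [c3], up to the small drift terms. *)
  assert (I1 := Ibp Sin).
  rewrite (mean_ext d e _ (Add (Add (Add Cos (Mul (Cst (- d)) (Mul Var Sin))) (Mul (Cst (- e)) (Cst 1))) (Mul (Cst e) (Mul Cos Cos)))) in I1.
  2:{ intros x. simpl. assert (H := SC x). nra. }
  assert (I2 := Ibp (Mul Sin Cos)).
  rewrite (mean_ext d e _ (Add (Add (Add (Cst (-1)) (Mul (Cst 2) (Mul Cos Cos))) (Mul (Cst (- d)) (Mul Var (Mul Sin Cos)))) (Mul (Cst (- e)) (Mul Cos (Mul Sin Sin))))) in I2.
  2:{ intros x. simpl. assert (H := SC x). nra. }
  assert (I3 := Ibp (Mul Sin (Mul Cos Cos))).
  rewrite (mean_ext d e _ (Add (Add (Add (Mul Cos (Mul Cos Cos)) (Mul (Cst (-2)) (Add Cos (Mul (Cst (-1)) (Mul Cos (Mul Cos Cos))))))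
     (Mul (Cst (- d)) (Mul Var (Mul Sin (Mul Cos Cos))))) (Mul (Cst (- e)) (Mul (Mul Cos Cos) (Mul Sin Sin))))) in I3.
  2:{ intros x. simpl.
      replace (sin x * (-1 * sin x * cos x + cos x * (-1 * sin x))) with (- 2 * cos x * (sin x * sin x)) by ring.
      rewrite SC. replace (sin x * (cos x * cos x) * (- d * x + - e * sin x)) with
       (- d * (x * (sin x * (cos x * cos x))) + - e * (cos x * cos x * (sin x * sin x))) by ring.
      rewrite SC. ring. }
  fold E in I1, I2, I3. rewrite !Lin, Ct in I1. rewrite !Lin, Ct in I2. rewrite !Lin in I3.
  fold c1 c2 c3 in I1, I2, I3.
  set (m1 := d * E (Mul Var Sin)) in *. set (m2 := d * E (Mul Var (Mul Sin Cos))) in *.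
  set (m3 := d * E (Mul Var (Mul Sin (Mul Cos Cos)))) in *.
  set (r2 := E (Mul Cos (Mul Sin Sin))) in *. set (r3 := E (Mul (Mul Cos Cos) (Mul Sin Sin))) in *.
  assert (J1 : c1 = m1 + e * (1 - c2)) by (unfold m1; lra).
  assert (J2 : 2 * c2 - 1 = m2 + e * r2) by (unfold m2; lra).
  assert (J3 : 3 * c3 = 2 * c1 + m3 + e * r3) by (unfold m3; lra).
  assert (FI : I_fun (density d e) = d + e * c1).
  { rewrite I_fun_density by exact Hd. unfold hess. fold E. rewrite Lin, Ct. reflexivity. }
  assert (FQ : Q_fun (density d e) = d ^ 2 + 2 * d * e * c1 + e ^ 2 * c2).
  { rewrite Q_fun_density by exact Hd.
    rewrite (mean_ext d e _ (Add (Add (Cst (d ^ 2)) (Mul (Cst (2 * d * e)) Cos)) (Mul (Cst (e ^ 2)) (Mul Cos Cos)))).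
    - fold E. rewrite !Lin, Ct. reflexivity.
    - intros x. simpl. ring. }
  assert (FD : D_fun (density d e) = e ^ 2 * (1 - c2)
     + 2 * (d ^ 3 + 3 * d ^ 2 * e * c1 + 3 * d * e ^ 2 * c2 + e ^ 3 * c3)).
  { rewrite D_fun_density by exact Hd.
    rewrite (mean_ext d e _ (Add (Add (Add (Cst (e ^ 2 + 2 * d ^ 3)) (Mul (Cst (6 * d ^ 2 * e)) Cos))
       (Mul (Cst (6 * d * e ^ 2 - e ^ 2)) (Mul Cos Cos))) (Mul (Cst (2 * e ^ 3)) (Mul Cos (Mul Cos Cos))))).
    - fold E. rewrite !Lin, Ct. fold c1 c2 c3. ring.
    - intros x. simpl.
      replace ((0 + (0 * cos x + e * (-1 * sin x))) * (0 + (0 * cos x + e * (-1 * sin x))))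
        with (e ^ 2 * (sin x * sin x)) by ring.
      rewrite SC. ring. }
  assert (H2 : 1 / 2 - e <= c2 <= 1 / 2 + e) by (split; nra).
  assert (H1 : - 2 * e <= c1 <= 2 * e) by (split; nra).
  assert (H3 : - 3 * e <= c3 <= 3 * e) by (split; nra).
  clear SC Hsin Hcos Drift Hsc2 Lin Ct Ibp.
  assert (He2 : 0 < e ^ 2) by (apply pow_lt; lra).
  assert (He3 : 0 < e ^ 3) by (apply pow_lt; lra).
  (* Errors are measured in units of [e ^ 3]; since [e <= 1 / 100], each power from the fourth on
     counts for at most a hundredth of a unit. *)
  assert (Pw : forall k, 0 <= e ^ (4 + k) <= e ^ 3 / 100).
  { intros k. split. apply pow_le; lra. replace (4 + k)%nat with (3 + S k)%nat by lia.
    rewrite pow_add. unfold Rdiv. apply Rmult_le_compat_l. lra.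
    assert (H := pow_incr e 1 k ltac:(lra)). rewrite pow1 in H.
    assert (0 <= e ^ k) by (apply pow_le; lra). simpl. nra. }
  assert (Ab : forall y z c, 0 <= y <= z -> -1 <= c <= 1 -> - z <= y * c <= z).
  { intros y z c Hy Hc. split; nra. }
  assert (Q1 := Ab _ _ c1 (Pw 1%nat) ltac:(lra)).
  assert (Q2 := Ab _ _ c1 (Pw 5%nat) ltac:(lra)).
  assert (Q3 := Ab _ _ c2 (Pw 2%nat) ltac:(lra)).
  assert (Q4 := Ab (e ^ 3) (e ^ 3) c3 ltac:(lra) ltac:(lra)).
  assert (Q5 := Pw 0%nat). assert (Q6 := Pw 4%nat). assert (Q7 := Pw 8%nat).
  simpl Nat.add in *.
  assert (Em : - (5 * e ^ 3) <= e * m1 <= 5 * e ^ 3).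
  { replace (e ^ 3) with (e * e ^ 2) by ring. split; nra. }
  assert (Ec : e ^ 2 / 2 - e ^ 3 <= e ^ 2 * c2 <= e ^ 2 / 2 + e ^ 3).
  { replace (e ^ 3) with (e ^ 2 * e) by ring.
    assert (L1 := Rmult_le_compat_l _ _ _ (Rlt_le _ _ He2) (proj1 H2)).
    assert (L2 := Rmult_le_compat_l _ _ _ (Rlt_le _ _ He2) (proj2 H2)). lra. }
  (* The bound [H1] on [c1] is too coarse here; [J1] recovers its leading part [e / 2]. The 7 rounds
     up 5 from the drift, 1 from [c2], and the higher powers. *)
  assert (KI : e ^ 2 * (1 / 2 - 7 * e) <= d + e * c1 <= e ^ 2 * (1 / 2 + 7 * e)).
  { rewrite J1. unfold d. split; lra. }
  assert (KQ : e ^ 2 * (1 / 2 - 2 * e) <= d ^ 2 + 2 * d * e * c1 + e ^ 2 * c2).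
  { unfold d. lra. }
  assert (KD : e ^ 2 * (1 - c2)
     + 2 * (d ^ 3 + 3 * d ^ 2 * e * c1 + 3 * d * e ^ 2 * c2 + e ^ 3 * c3) <= e ^ 2 * (1 / 2 + 7 * e)).
  { unfold d. lra. }
  rewrite <- FI in KI. rewrite <- FQ in KQ. rewrite <- FD in KD.
  assert (HL : 0 < e ^ 2 * (1 / 2 - 2 * e)) by (apply Rmult_lt_0_compat; lra).
  assert (HM : 0 < e ^ 2 * (1 / 2 - 7 * e)) by (apply Rmult_lt_0_compat; lra).
  assert (HQ : 0 < Q_fun (density d e)) by lra.
  exists (I_fun (density d e) * D_fun (density d e) / Q_fun (density d e) ^ 2).
  split.
  { exists (density d e). split; [|reflexivity]. apply density_admissible; assumption. }
  set (i := I_fun (density d e)) in *. set (q := Q_fun (density d e)) in *. set (D := D_fun (density d e)) in *.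
  clearbody i q D.
  apply (proj2 (Rle_div_l _ _ _ (pow_lt _ 2 HQ))).
  set (M := e ^ 2 * (1 / 2 + 7 * e)) in *. set (L := e ^ 2 * (1 / 2 - 2 * e)) in *.
  assert (Hi : 0 <= i) by lra.
  assert (P1 : i * D <= M ^ 2).
  { apply Rle_trans with (i * M). apply Rmult_le_compat_l; lra.
    simpl pow. rewrite Rmult_1_r. apply Rmult_le_compat_r; lra. }
  assert (P2 : L ^ 2 <= q ^ 2) by (apply pow_incr; lra).
  (* Both [1 / 2 + 7 * e <= (1 + 20 * e) * (1 / 2 - 2 * e)] and [(1 + 20 * e) ^ 2 <= 1 + 50 * e]
     follow from [e <= 1 / 100]. *)
  assert (P3 : M ^ 2 <= (1 + 50 * e) * L ^ 2).
  { assert (Hee : e * e <= e * (1 / 100)) by (apply Rmult_le_compat_l; lra).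
    assert (ML : M <= (1 + 20 * e) * L).
    { unfold M, L. rewrite <- Rmult_assoc, (Rmult_comm (1 + 20 * e)), Rmult_assoc.
      apply Rmult_le_compat_l. lra. lra. }
    apply Rle_trans with (((1 + 20 * e) * L) ^ 2).
    - apply pow_incr. lra.
    - rewrite Rpow_mult_distr. apply Rmult_le_compat_r. apply pow2_ge_0. lra. }
  apply Rle_trans with ((1 + 50 * e) * L ^ 2). lra.
  apply Rmult_le_compat_l; lra.
Qed.

(* theta_1^* = inf ratio_set = 1 *)
Theorem theorem7p1 : is_glb_Rbar ratio_set (Finite 1).
Proof.
  split.
  - intros r Hr. exact (ratio_set_ge_1 r Hr).
  - intros b Hb.
    assert (K : forall e, 0 < e <= 1 / 100 -> Rbar_le b (1 + 50 * e)).
    { intros e He. destruct (ratio_set_near_1 e He) as [r [Hr Hle]].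
      eapply Rbar_le_trans. apply (Hb r Hr). exact Hle. }
    destruct b as [b| |].
    + simpl in *. destruct (Rle_dec b 1) as [H|H]; [exact H|exfalso].
      (* For this [e], [1 + 50 * e] is at most [1 + (b - 1) / 2], which is below [b]. *)
      assert (H1 := K (Rmin (1 / 100) ((b - 1) / 100))).
      assert (H2 := Rmin_l (1 / 100) ((b - 1) / 100)).
      assert (H3 := Rmin_r (1 / 100) ((b - 1) / 100)).
      assert (H4 : 0 < Rmin (1 / 100) ((b - 1) / 100)) by (apply Rmin_glb_lt; lra).
      specialize (H1 (conj H4 H2)). lra.
    + apply (K (1 / 100)). lra.
    + exact I.
Qed.
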